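(* Let $k$ be a perfect field, $n\ge 2$, $S=k[[X_1,\dots,X_n]]$ with maximal ideal $\mathfrak{n}=(X_1,\dots,X_n)$, and let $R=S/I$ be a one-dimensional (Noetherian complete local) domain. Assume $I\subseteq \mathfrak{n}^{s+1}$ for some integer $s\ge 1$. If $$h(\Omega_{R/k})<\binom{n+s}{s}\frac{s}{s+1},$$ then $\Omega_{R/k}$ has torsion, i.e. its torsion submodule $\tau(\Omega_{R/k})$ is non-zero. In particular, Berger's Conjecture is true for $R$ whenever $h(\Omega_{R/k})$ satisfies this bound.
   Context: Universally finite module of differentials: for $R=S/I$ with $S=k[[X_1,\dots,X_n]]$ and $I=(f_1,\dots,f_m)$, $\Omega_{R/k}$ is the finitely generated $R$-module $\left(\bigoplus_{i=1}^n R\,dX_i\right)/U$, where $U$ is the $R$-submodule generated by $df_j=\sum_{i=1}^n \frac{\partial f_j}{\partial X_i}dX_i$, $j=1,\dots,m$ (partial derivatives taken in $S$ and reduced modulo $I$). Its torsion submodule is denoted $\tau(\Omega_{R/k})$. Invariant $h$: for a Noetherian local one-dimensional domain $R$ and a finitely generated $R$-module $M$ of non-zero rank, $$h(M):=\min\{\lambda(R/J)\mid J=\phi(M)\text{ for some }R\text{-homomorphism }\phi:M\to R\},$$ where $\lambda$ denotes length as an $R$-module (the zero map contributes $\lambda(R)=\infty$). Berger's Conjecture (domain case): for $k$ perfect and $R$ a complete one-dimensional local $k$-algebra which is a domain, $R$ is regular if and only if $\tau(\Omega_{R/k})=0$. *)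

(* Defs.v *)
From HB Require Import structures.
From mathcomp Require Import all_boot all_order all_algebra.
From mathcomp Require Import ring_quotient generic_quotient.
From mathcomp Require Import boolp classical_sets mpoly.
(* The notations of constructive_ereal and of mpoly cannot be loaded together;
   below, [extended rat], [EFin q] and [EPInf rat] stand for the type of extended
   rationals, the finite element q and +oo. *)
From mathcomp Require Import -(notations) constructive_ereal.

Set Implicit Arguments.
Unset Strict Implicit.
Unset Printing Implicit Defensive.

Import Order.TTheory GRing.Theory Num.Theory.
Local Open Scope ring_scope.
Local Open Scope classical_set_scope.
Local Open Scope quotient_scope.

(* In characteristic 0 the condition is vacuous. *)
Definition perfect_field (k : fieldType) : Prop :=
  forall p, p \in [pchar k] -> forall x : k, exists y : k, y ^+ p = x.

Record pseries (n : nat) (k : Type) : Type :=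
  PSeries { pscoef : 'X_{1..n} -> k }.

Section PowerSeries.
Variables (n : nat) (k : comNzRingType).
Local Notation S := (pseries n k).

HB.instance Definition _ := gen_eqMixin (pseries n k).
HB.instance Definition _ := gen_choiceMixin (pseries n k).

Lemma pseriesP (f g : S) : (forall m, pscoef f m = pscoef g m) <-> f = g.
Proof.
split=> [|-> //]; case: f g => [f] [g] /= fg; congr PSeries; exact: funext.
Qed.

Definition ps0 : S := PSeries (fun _ => 0).
Definition ps1 : S := PSeries (fun m => (m == 0%MM)%:R).
Definition psopp (f : S) : S := PSeries (fun m => - pscoef f m).
Definition psadd (f g : S) : S := PSeries (fun m => pscoef f m + pscoef g m).
Definition psmul (f g : S) : S := PSeries (fun m =>
  \sum_(c : 'X_{1..n < (mdeg m).+1, (mdeg m).+1} | m == (c.1 + c.2)%MM)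
    pscoef f c.1 * pscoef g c.2).

Fact psaddA : associative psadd.
Proof. by move=> f g e; apply/pseriesP => m /=; rewrite addrA. Qed.
Fact psaddC : commutative psadd.
Proof. by move=> f g; apply/pseriesP => m /=; rewrite addrC. Qed.
Fact psadd0 : left_id ps0 psadd.
Proof. by move=> f; apply/pseriesP => m /=; rewrite add0r. Qed.
Fact psaddN : left_inverse ps0 psopp psadd.
Proof. by move=> f; apply/pseriesP => m /=; rewrite addNr. Qed.

HB.instance Definition _ :=
  GRing.isZmodule.Build (pseries n k) psaddA psaddC psadd0 psaddN.

Definition pstrunc (d : nat) (f : S) : {mpoly k[n]} :=
  \sum_(m : 'X_{1..n < d}) pscoef f m *: 'X_[m].

Lemma mcoeff_pstrunc d f m : (mdeg m < d)%N -> (pstrunc d f)@_m = pscoef f m.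
Proof. exact: mcoeff_mpoly. Qed.

Lemma pscoefM_mpoly (f g : S) (p q : {mpoly k[n]}) m :
    (forall c, (mdeg c <= mdeg m)%N -> p@_c = pscoef f c) ->
    (forall c, (mdeg c <= mdeg m)%N -> q@_c = pscoef g c) ->
  pscoef (psmul f g) m = (p * q)@_m.
Proof.
move=> pf qg; rewrite mcoeffM /=; apply: eq_bigr => -[a b] /= _.
by rewrite pf ?qg // -ltnS bmdeg.
Qed.

Fact psmulA : associative psmul.
Proof.
move=> f g e; apply/pseriesP => m; pose t := pstrunc (mdeg m).+1.
have tE h c : (mdeg c <= mdeg m)%N -> (t h)@_c = pscoef h c.
  by move=> cm; rewrite mcoeff_pstrunc.
have tM h1 h2 c : (mdeg c <= mdeg m)%N ->
    (t h1 * t h2)@_c = pscoef (psmul h1 h2) c.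
  by move=> cm; symmetry; apply: pscoefM_mpoly => b bc; apply: tE;
    exact: leq_trans cm.
rewrite (pscoefM_mpoly (tE f) (tM g e)) (pscoefM_mpoly (tM f g) (tE e)).
by rewrite mulrA.
Qed.

Fact psmulC : commutative psmul.
Proof.
move=> f g; apply/pseriesP => m; pose t := pstrunc (mdeg m).+1.
have tE h c : (mdeg c <= mdeg m)%N -> (t h)@_c = pscoef h c.
  by move=> cm; rewrite mcoeff_pstrunc.
by rewrite (pscoefM_mpoly (tE f) (tE g)) (pscoefM_mpoly (tE g) (tE f)) mulrC.
Qed.

Fact psmul1 : left_id ps1 psmul.
Proof.
move=> f; apply/pseriesP => m; pose t := pstrunc (mdeg m).+1.
have tE h c : (mdeg c <= mdeg m)%N -> (t h)@_c = pscoef h c.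
  by move=> cm; rewrite mcoeff_pstrunc.
have t1 c : (mdeg c <= mdeg m)%N -> (1 : {mpoly k[n]})@_c = pscoef ps1 c.
  by move=> _; rewrite mcoeff1.
by rewrite (pscoefM_mpoly t1 (tE f)) mul1r tE.
Qed.

Fact psmulDl : left_distributive psmul psadd.
Proof.
move=> f g e; apply/pseriesP => m /=; rewrite -big_split /=.
by apply: eq_bigr => c _; rewrite mulrDl.
Qed.

Fact ps1_neq0 : ps1 != 0 :> S.
Proof.
apply/eqP => /pseriesP /(_ 0%MM) /=.
by rewrite eqxx => /eqP; rewrite oner_eq0.
Qed.

HB.instance Definition _ := GRing.Zmodule_isComNzRing.Build (pseries n k)
  psmulA psmulC psmul1 psmulDl ps1_neq0.

Definition psX (i : 'I_n) : S := PSeries (fun m => (m == U_(i)%MM)%:R).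

Definition psderiv (i : 'I_n) (f : S) : S :=
  PSeries (fun m => pscoef f (m + U_(i))%MM *+ (m i).+1).

End PowerSeries.

Section Modules.
Variables (R : nzRingType) (M : lmodType R).

Definition span (A : set M) : {pred M} :=
  fun x => `[< forall N : submodClosed M, (forall a, A a -> a \in N) -> x \in N >].

Fact span_addr_closed (A : set M) : Algebra.nmod_closed (span A).
Proof.
split; first by apply/asboolP => N _; rewrite rpred0.
by move=> x y /asboolP xA /asboolP yA; apply/asboolP => N AN;
  rewrite rpredD ?xA ?yA.
Qed.
Fact span_scaler_closed (A : set M) : GRing.scaler_closed (span A).
Proof.
by move=> r x /asboolP xA; apply/asboolP => N AN; rewrite rpredZ ?xA.
Qed.
HB.instance Definition _ (A : set M) :=
  GRing.isAddClosed.Build M (span A) (span_addr_closed A).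
HB.instance Definition _ (A : set M) :=
  GRing.isScaleClosed.Build R M (span A) (@span_scaler_closed A).

Fact submod_oppr_closed (N : submodClosed M) : oppr_closed N.
Proof. by move=> x xN; rewrite -scaleN1r rpredZ. Qed.

Definition submod_pred (N : submodClosed M) : {pred M} := N.
HB.instance Definition _ N := GRing.SubmodClosed.on (submod_pred N).
HB.instance Definition _ N :=
  GRing.isOppClosed.Build M (submod_pred N) (@submod_oppr_closed N).

Definition lmquot (N : submodClosed M) : Type :=
  Quotient.quot (submod_pred N : zmodClosed M).

Section QuotientModule.
Variable N : submodClosed M.
Local Notation Q := (lmquot N).
HB.instance Definition _ := GRing.Zmodule.on Q.
HB.instance Definition _ := EqQuotient.on Q.

Definition lmquot_scale (r : R) (x : Q) : Q := \pi_Q (r *: repr x).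

Lemma lmquot_eqP (x y : M) : reflect (\pi_Q x = \pi_Q y) (x - y \in N).
Proof.
by have := @Quotient.idealrBE M (submod_pred N : zmodClosed M) x y => ->; apply: eqP.
Qed.

Lemma lmquot_scaleE r x : lmquot_scale r (\pi_Q x) = \pi_Q (r *: x).
Proof.
by apply/lmquot_eqP; rewrite -scalerBr rpredZ //; apply/lmquot_eqP; rewrite reprK.
Qed.

Lemma lmquot_piD (x y : M) : \pi_Q (x + y) = \pi_Q x + \pi_Q y.
Proof. exact: (raddfD (\pi_(Quotient.quot (submod_pred N)))). Qed.

Fact lmquot_scalerA r s x :
  lmquot_scale r (lmquot_scale s x) = lmquot_scale (r * s) x.
Proof.
by elim/quotW: x => x; rewrite (lmquot_scaleE s x) !lmquot_scaleE scalerA.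
Qed.
Fact lmquot_scale1 : left_id 1 lmquot_scale.
Proof. by elim/quotW => x; rewrite lmquot_scaleE scale1r. Qed.
Fact lmquot_scalerDr : right_distributive lmquot_scale +%R.
Proof.
move=> r; elim/quotW => x; elim/quotW => y.
by rewrite -lmquot_piD !lmquot_scaleE scalerDr lmquot_piD.
Qed.
Fact lmquot_scalerDl x : {morph lmquot_scale^~ x : r s / r + s}.
Proof.
by elim/quotW: x => x r s; rewrite !lmquot_scaleE scalerDl lmquot_piD.
Qed.
HB.instance Definition _ := GRing.Zmodule_isLmodule.Build R Q
  lmquot_scalerA lmquot_scale1 lmquot_scalerDr lmquot_scalerDl.

End QuotientModule.

Definition submod_chain (l : nat) : Prop :=
  exists N : nat -> submodClosed M, forall i, (i < l)%N ->
    {subset N i <= N i.+1} /\ ~ {subset N i.+1 <= N i}.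

(* The supremum exists in the extended rationals: it is the largest element of
   the set, or +oo when the chains have unbounded lengths. *)
Definition module_length : extended rat :=
  supremum (EFin 0) [set EFin (l%:R : rat) | l in submod_chain].

Definition torsion : set M :=
  [set x | exists r : R, GRing.lreg r /\ r *: x = 0].

Section LinearImage.
Variables (M' : lmodType R) (phi : {linear M -> M'}).

Definition lin_image : {pred M'} := fun y => `[< exists x, phi x = y >].

Fact lin_image_addr_closed : Algebra.nmod_closed lin_image.
Proof.
split; first by apply/asboolP; exists 0; rewrite raddf0.
by move=> _ _ /asboolP[x <-] /asboolP[y <-]; apply/asboolP; exists (x + y);
  rewrite raddfD.
Qed.
Fact lin_image_scaler_closed : GRing.scaler_closed lin_image.
Proof.
by move=> r _ /asboolP[x <-]; apply/asboolP; exists (r *: x); rewrite linearZ.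
Qed.
HB.instance Definition _ :=
  GRing.isAddClosed.Build M' lin_image lin_image_addr_closed.
HB.instance Definition _ :=
  GRing.isScaleClosed.Build R M' lin_image lin_image_scaler_closed.

End LinearImage.
End Modules.

Arguments submod_chain {R} M l.
Arguments module_length {R} M.
Arguments torsion {R} M.

(* The minimum is attained, the values being natural numbers or +oo. *)
Definition h_inv (R : comNzRingType) (M : lmodType R) : extended rat :=
  let L := [set module_length (lmquot (lin_image phi)) |
             phi in [set: {linear M -> R^o}]] in
  xget (EPInf rat) (L `&` lbound L).

Section Ideals.
Variable R : comNzRingType.

Definition ideal_gen (A : set R) : {pred R} := span (A : set R^o).

Definition ideal_mul (I J : {pred R}) : {pred R} :=
  ideal_gen [set x | exists a b, [/\ a \in I, b \in J & x = a * b]].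

Definition ideal_exp (I : {pred R}) (e : nat) : {pred R} :=
  iter e (ideal_mul I) predT.

Definition noetherian_ring : Prop :=
  forall J : submodClosed R^o, exists d (x : 'I_d -> R), J =i ideal_gen (range x).

Definition prime_chain (l : nat) : Prop :=
  exists P : nat -> prime_idealr R, forall i, (i < l)%N ->
    {subset P i <= P i.+1} /\ ~ {subset P i.+1 <= P i}.

Definition krull_dim (d : nat) : Prop :=
  prime_chain d /\ forall l, prime_chain l -> (l <= d)%N.

(* [idealr R] is the type of proper ideals of R. *)
Definition maximal_ideal (m : idealr R) : Prop :=
  forall J : idealr R, {subset m <= J} -> J =i m.

Definition local_ring (m : idealr R) : Prop :=
  maximal_ideal m /\ forall m' : idealr R, maximal_ideal m' -> m' =i m.

Definition regular_local_ring : Prop :=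
  noetherian_ring /\
  exists (m : idealr R) (d : nat) (x : 'I_d -> R),
    [/\ local_ring m, krull_dim d & m =i ideal_gen (range x)].

End Ideals.

Definition ps_max (n : nat) (k : fieldType) : {pred pseries n k} :=
  ideal_gen (range (@psX n k)).

Arguments ps_max n k : clear implicits.

Section Differentials.
Variables (n : nat) (k : fieldType) (I : idealr (pseries n k)).
Local Notation R := {ideal_quot I}.

Definition ps_diff (g : pseries n k) : 'rV[R]_n := \row_i \pi_R (psderiv i g).

(* The universally finite module of differentials of R = k[[X]]/I presented by
   generators f_j of I; the i-th basis vector of 'rV[R]_n is dX_i. *)
Definition Omega (m : nat) (f : 'I_m -> pseries n k) : lmodType R :=
  lmquot (span (range (ps_diff \o f))).

End Differentials.

(* Main.v *)
Require Import Defs.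
From HB Require Import structures.
From mathcomp Require Import all_boot all_order all_algebra.
From mathcomp Require Import ring_quotient generic_quotient.
From mathcomp Require Import boolp classical_sets mpoly.
From mathcomp Require Import ring.
From mathcomp Require Import -(notations) constructive_ereal.

Set Implicit Arguments.
Unset Strict Implicit.
Unset Printing Implicit Defensive.

Import Order.TTheory GRing.Theory Num.Theory.
Local Open Scope ring_scope.
Local Open Scope classical_set_scope.

(** Suppose that the module of differentials is torsion-free, and let [phi] be a
    linear form on it, with values [u_i] on the [dX_i] and image [J].

    A linear form on the module of differentials is a derivation of [R], and any
    two derivations of [R] are proportional ([derivations_proportional]). Indeed
    [R] is a finite module over the power series in one variable [X_i]
    ([finite_over_one_var]); in characteristic zero it is therefore algebraic
    over them ([der_algebraic]), and in characteristic [p], because the residue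
    field is perfect, its fraction field has degree [p] over its [p]-th powers
    ([dependent_pth_powers]). Hence, if [u] is not zero, every syzygy of [u] is a
    torsion element, that is, a combination of the gradients of the generators
    of [I] ([syzygy_span]). Modulo terms of degree greater than [s] it is the
    gradient of a single element of [I] ([syzygy_gradient]), so that its entries
    have order at least [s].

    Applied to the Koszul syzygies, this shows that the [u_i] have order at least
    [s], so that the image of [J] modulo terms of degree greater than [s] is
    spanned by [n] elements. Counting monomials, the colength of [J] is at least
    [binomial (n + s) s - n] ([submod_chain_image]), and [n (s + 1)] is at most
    the binomial coefficient if [s] is at least two. If [s = 1], the symmetry of
    Hessian matrices forces the linear parts of the [u_i] to span a space of
    dimension at most one ([linear_part_rank1]), so that the colength is at least
    [binomial (n + 1) 1 - 1]. If [u = 0], the colength is at least the binomial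
    coefficient itself. Each of these numbers is at least the bound that the
    hypothesis puts strictly above the colength for a suitable [phi].

    Finally, [R] is not regular: its maximal ideal would be principal, whereas
    the classes of at least two variables are linearly independent modulo its
    square ([not_regular]). *)

(** * Power series *)

Section PowerSeriesTheory.
Variables (n : nat) (k : fieldType).
Local Notation S := (pseries n k).
Implicit Types (f g : S) (m : 'X_{1..n}).

Lemma pscoefD f g m : pscoef (f + g) m = pscoef f m + pscoef g m.
Proof. by []. Qed.
Lemma pscoefN f m : pscoef (- f) m = - pscoef f m.
Proof. by []. Qed.
Lemma pscoefB f g m : pscoef (f - g) m = pscoef f m - pscoef g m.
Proof. by []. Qed.
Lemma pscoef0 m : pscoef (0 : S) m = 0.
Proof. by []. Qed.
Lemma pscoef1 m : pscoef (1 : S) m = (m == 0%MM)%:R.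
Proof. by []. Qed.
Lemma pscoef_sum (T : Type) (r : seq T) (P : pred T) (F : T -> S) m :
  pscoef (\sum_(i <- r | P i) F i) m = \sum_(i <- r | P i) pscoef (F i) m.
Proof. exact: (big_morph _ (fun f g => pscoefD f g m) (pscoef0 m)). Qed.
Lemma pscoefMn f i m : pscoef (f *+ i) m = pscoef f m *+ i.
Proof. by elim: i => [//|i IH]; rewrite !mulrS pscoefD IH. Qed.

Lemma pscoefM f g m : pscoef (f * g) m =
  \sum_(c : 'X_{1..n < (mdeg m).+1, (mdeg m).+1} | m == (c.1 + c.2)%MM)
    pscoef f c.1 * pscoef g c.2.
Proof. by []. Qed.

Lemma pscoefM_trunc d f g m : (mdeg m < d)%N ->
  pscoef (f * g) m = (pstrunc d f * pstrunc d g)@_m.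
Proof.
move=> md; apply: pscoefM_mpoly => c cm;
  by rewrite mcoeff_pstrunc // (leq_ltn_trans cm).
Qed.

(** The [d]-th power of the maximal ideal, described by coefficients: only this
    description is closed under infinite sums at sight. *)
Definition low d f := forall m, (mdeg m < d)%N -> pscoef f m = 0.

Lemma low0 d : low d 0. Proof. by []. Qed.
Lemma lowW d e f : (e <= d)%N -> low d f -> low e f.
Proof. by move=> ed lf m me; apply: lf; apply: leq_trans ed. Qed.
Lemma lowD d f g : low d f -> low d g -> low d (f + g).
Proof. by move=> lf lg m md; rewrite pscoefD lf ?lg ?addr0. Qed.
Lemma lowN d f : low d f -> low d (- f).
Proof. by move=> lf m md; rewrite pscoefN lf ?oppr0. Qed.
Lemma lowB d f g : low d f -> low d g -> low d (f - g).
Proof. by move=> lf lg; apply: lowD => //; apply: lowN. Qed.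
Lemma low_sum d (T : Type) (r : seq T) (P : pred T) (F : T -> S) :
  (forall i, P i -> low d (F i)) -> low d (\sum_(i <- r | P i) F i).
Proof.
move=> lF; elim/big_ind: _ => [|f g|//]; [exact: low0|exact: lowD].
Qed.
Lemma lowM d e f g : low d f -> low e g -> low (d + e) (f * g).
Proof.
move=> lf lg m md; rewrite pscoefM big1 // => -[[a ha] [b hb]] /= /eqP mE.
have [ad|ad] := ltnP (mdeg a) d; first by rewrite lf ?mul0r.
rewrite lg ?mulr0 //; move: md; rewrite mE mdegD => md.
by rewrite -(ltn_add2l d); apply: leq_ltn_trans md; rewrite leq_add2r.
Qed.
Lemma lowMl d f g : low d g -> low d (f * g).
Proof. exact: (@lowM 0%N d). Qed.
Lemma lowMr d f g : low d f -> low d (f * g).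
Proof. by rewrite mulrC; apply: lowMl. Qed.
Lemma lowX d i f : low d f -> low (d * i) (f ^+ i).
Proof.
move=> lf; elim: i => [|i IH]; first by rewrite muln0.
by rewrite exprS mulnS; apply: lowM.
Qed.
Lemma low1X i f : low 1 f -> low i (f ^+ i).
Proof. by move=> lf; rewrite -[X in low X]mul1n; apply: lowX. Qed.

Lemma low_eq f g : (forall d, low d (f - g)) -> f = g.
Proof.
move=> fg; apply/pseriesP => m; apply/eqP; rewrite -subr_eq0 -pscoefB.
by apply/eqP; apply: (fg (mdeg m).+1).
Qed.

Definition psXm (a : 'X_{1..n}) : S := PSeries (fun m => (m == a)%:R).
Definition psC (c : k) : S := PSeries (fun m => c *+ (m == 0%MM)).

Lemma psX_psXm i : psX k i = psXm U_(i).
Proof. by []. Qed.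
Lemma psXm0 : psXm 0%MM = 1.
Proof. by []. Qed.

Lemma pscoef_psXm a m : pscoef (psXm a) m = (m == a)%:R. Proof. by []. Qed.

Lemma low_psXm a : low (mdeg a) (psXm a).
Proof.
by move=> m md /=; case: eqP md => // ->; rewrite ltnn.
Qed.
Lemma low_psX i : low 1 (psX k i).
Proof. by rewrite psX_psXm -(mdeg1 i); apply: low_psXm. Qed.

Lemma trunc_psXm d a : (mdeg a < d)%N -> pstrunc d (psXm a) = 'X_[a].
Proof.
move=> ad; apply/mpolyP => m; rewrite mcoeffX.
have [md|md] := ltnP (mdeg m) d; first by rewrite mcoeff_pstrunc //= eq_sym.
rewrite (_ : (a == m) = false); last first.
  by apply/eqP => aE; move: ad; rewrite aE ltnNge md.
rewrite /pstrunc raddf_sum big1 // => -[c hc] _ /=.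
rewrite mcoeffZ mcoeffX; have [cE|_] := eqVneq c m; last by rewrite mulr0.
by move: hc; rewrite cE ltnNge md.
Qed.

Lemma pscoef_psXmM a f m :
  pscoef (psXm a * f) m = if (a <= m)%MM then pscoef f (m - a)%MM else 0.
Proof.
pose d := (maxn (mdeg m) (mdeg a)).+1.
have md : (mdeg m < d)%N by rewrite ltnS leq_maxl.
have ad : (mdeg a < d)%N by rewrite ltnS leq_maxr.
rewrite (pscoefM_trunc _ _ md) trunc_psXm // mulrC.
case: ifP => am.
  rewrite -{1}(submK am) addmC mcoeffMX mcoeff_pstrunc //.
  by apply: leq_ltn_trans (mdegB _ _) md.
apply: memN_msupp_eq0; apply/negP => /msuppM_le /allpairsP[[u v] /= [_]].
by rewrite msuppX inE => /eqP-> mE; move: am; rewrite mE lem_addl.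
Qed.

Lemma psXmM a b : psXm a * psXm b = psXm (a + b)%MM.
Proof.
apply/pseriesP => m; rewrite pscoef_psXmM /=; case: ifP => am.
  by rewrite -(eqm_add2r a) submK // addmC.
by case: eqP => // mE; move: am; rewrite mE lem_addr.
Qed.

Lemma psXmX a i : psXm a ^+ i = psXm (a *+ i)%MM.
Proof.
elim: i => [|i IH]; first by rewrite mulm0n.
by rewrite exprS IH psXmM mulmS.
Qed.

Lemma pscoef_CM c f m : pscoef (psC c * f) m = c * pscoef f m.
Proof.
pose d := (mdeg m).+1.
rewrite (@pscoefM_trunc d) // (_ : pstrunc d (psC c) = c%:MP).
  by rewrite mcoeffCM mcoeff_pstrunc.
apply/mpolyP => a; rewrite mcoeffC.
have [ad|ad] := ltnP (mdeg a) d; first by rewrite mcoeff_pstrunc //= mulr_natr.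
rewrite (_ : (a == 0%MM) = false); last first.
  by apply/eqP => aE; move: ad; rewrite aE mdeg0.
rewrite mulr0 /pstrunc raddf_sum big1 // => -[e he] _ /=.
rewrite mcoeffZ mcoeffX; have [eE|_] := eqVneq e a; last by rewrite mulr0.
by move: he; rewrite eE ltnNge ad.
Qed.

Lemma psC0 : psC 0 = 0.
Proof. by apply/pseriesP => m /=; rewrite mul0rn. Qed.
Lemma psC1 : psC 1 = 1. Proof. by []. Qed.
Lemma psCD c d : psC (c + d) = psC c + psC d.
Proof. by apply/pseriesP => m; rewrite pscoefD /= mulrnDl. Qed.
Lemma psCM c d : psC (c * d) = psC c * psC d.
Proof. by apply/pseriesP => m; rewrite pscoef_CM /= mulrnAr. Qed.
Lemma psC_low c f : c = pscoef f 0%MM -> low 1 (f - psC c).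
Proof.
move=> -> m; rewrite ltnS leqn0 mdeg_eq0 => /eqP->.
by rewrite pscoefB /= eqxx subrr.
Qed.

Lemma pscoefM0 f g : pscoef (f * g) 0%MM = pscoef f 0%MM * pscoef g 0%MM.
Proof.
rewrite -[f](subrK (psC (pscoef f 0%MM))) mulrDl pscoefD pscoef_CM.
rewrite [X in X + _](_ : _ = 0); last first.
  by apply: (@lowMr 1); [apply: psC_low|rewrite mdeg0].
by rewrite add0r pscoefD pscoefB /= eqxx mulr1n subrr add0r.
Qed.

Lemma pscoefM_low d f g m : low d f -> mdeg m = d ->
  pscoef (f * g) m = pscoef f m * pscoef g 0%MM.
Proof.
move=> lf md; rewrite mulrC -[g](subrK (psC (pscoef g 0%MM))) mulrDl pscoefD.
rewrite pscoef_CM [X in X + _](_ : _ = 0); last first.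
  by apply: (@lowM 1 d) => //; [apply: psC_low|rewrite md].
by rewrite add0r pscoefD pscoefB /= eqxx mulr1n subrr add0r mulrC.
Qed.

(** Dividing each monomial by the first variable that occurs in it assigns it to
    one summand only. *)
Lemma low_split d f : low d.+1 f ->
  exists2 g : 'I_n -> S, f = \sum_i psX k i * g i & forall i, low d (g i).
Proof.
move=> lf.
pose first (i : 'I_n) m := [forall j : 'I_n, (j < i)%N ==> (m j == 0%N)].
exists (fun i => PSeries (fun m => pscoef f (m + U_(i))%MM *+ first i m)).
  apply/pseriesP => m; rewrite pscoef_sum.
  under eq_bigr => i _ do rewrite psX_psXm pscoef_psXmM /= lep1mP.
  have [->|/eqP m0] := eqVneq m 0%MM.
    by rewrite lf ?mdeg0 // big1 // => i _; rewrite mnm0E eqxx.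
  have /existsP[i0 mi0] : [exists i : 'I_n, m i != 0%N].
    apply/existsPn => h; apply: m0; apply/mnmP => i.
    by rewrite mnm0E; apply/eqP; move: (h i); rewrite negbK.
  case: (@arg_minnP _ i0 (fun i : 'I_n => m i != 0%N) (fun i => i : nat) mi0).
  move=> i mi imin; have Ui : (U_(i) <= m)%MM by rewrite lep1mP.
  rewrite (bigD1 i) //= mi submK // [first _ _](_ : _ = true).
    rewrite big1 ?addr0 // => j ji; case: ifP => // mj.
    have ij : (i < j)%N.
      by rewrite ltn_neqAle imin // andbT eq_sym; apply: contra ji => /eqP/ord_inj->.
    rewrite [first _ _](_ : _ = false) ?mulr0n //; apply/negP => /forallP/(_ i).
    by rewrite ij mnmBE mnm1E (negbTE ji) subn0 (negbTE mi).
  apply/forallP => j; apply/implyP => ji.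
  rewrite mnmBE; case: eqP => //; case: (eqVneq (m j) 0%N) => [->//|mj].
  by move: ji; rewrite ltnNge imin.
by move=> i m md /=; rewrite lf ?mul0rn // mdegD mdeg1 addn1.
Qed.

(** Splitting off one variable at a time leads from a series of order [d] to the
    monomials of degree [d]. *)
Lemma low_ideal (Q : S -> Prop) :
    Q 0 -> (forall f g, Q f -> Q g -> Q (f + g)) ->
    (forall f g, Q g -> Q (f * g)) ->
  forall d, (forall a : 'X_{1..n}, mdeg a = d -> Q (psXm a)) ->
  forall f, low d f -> Q f.
Proof.
move=> Q0 QD QM d Qd f lf.
suff Qe e a g : low e g -> (mdeg a + e)%N = d -> Q (psXm a * g).
  by rewrite -[f]mul1r -psXm0; apply: (Qe d); rewrite ?mdeg0.
elim: e a g => [|e IH] a g lg ad.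
  by rewrite mulrC; apply: QM; apply: Qd; rewrite addn0 in ad.
have [h -> lh] := low_split lg; rewrite mulr_sumr.
elim/big_ind: _ => [//|//|i _]; rewrite mulrA psX_psXm psXmM.
by apply: IH; rewrite // mdegD mdeg1 -addnA add1n.
Qed.

(** The infinite sum of the [F i], meant for terms [F i] of order at least [i]:
    those with [i] greater than the degree of [m] then have coefficient zero
    at [m], so that a finite sum gives the coefficient. *)
Definition psum (F : nat -> S) : S :=
  PSeries (fun m => \sum_(i < (mdeg m).+1) pscoef (F i) m).

Lemma psum_low F : (forall i, low i (F i)) ->
  forall d, low d (psum F - \sum_(i < d) F i).
Proof.
move=> lF d m md; rewrite pscoefB /= pscoef_sum.
rewrite -(big_mkord xpredT (fun i => pscoef (F i) m)).
rewrite -[X in _ - X](big_mkord xpredT (fun i => pscoef (F i) m)).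
rewrite (big_cat_nat (n := (mdeg m).+1) _ md) //= opprD addrA subrr add0r.
rewrite big1_seq ?oppr0 // => i /andP[_]; rewrite mem_index_iota => /andP[mi _].
exact: lF.
Qed.

Lemma psum_unique F f : (forall i, low i (F i)) ->
  (forall d, low d (f - \sum_(i < d) F i)) -> f = psum F.
Proof.
move=> lF fF; apply: low_eq => d.
have -> : f - psum F = (f - \sum_(i < d) F i) - (psum F - \sum_(i < d) F i).
  by rewrite opprB addrA subrK.
by apply: lowB => //; apply: psum_low.
Qed.

Lemma psumM F g : (forall i, low i (F i)) ->
  g * psum F = psum (fun i => g * F i).
Proof.
move=> lF; apply: psum_unique => [i|d]; first exact: lowMl.
by rewrite -mulr_sumr -mulrBr; apply: lowMl; apply: psum_low.
Qed.

Lemma psumD F G : (forall i, low i (F i)) -> (forall i, low i (G i)) ->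
  psum F + psum G = psum (fun i => F i + G i).
Proof.
by move=> lF lG; apply/pseriesP => m; rewrite pscoefD /= -big_split.
Qed.

Lemma psum_sum (T : Type) (r : seq T) (F : T -> nat -> S) :
  \sum_(t <- r) psum (F t) = psum (fun i => \sum_(t <- r) F t i).
Proof.
apply/pseriesP => m; rewrite pscoef_sum /= exchange_big /=.
by apply: eq_bigr => i _; rewrite pscoef_sum.
Qed.

(** Up to a constant, [f] is [1 - t] with [t] in the maximal ideal, and the
    geometric series in [t] converges. *)
Lemma ps_unit f : pscoef f 0%MM != 0 -> exists g, f * g = 1.
Proof.
move=> f0; pose c := pscoef f 0%MM; pose t := 1 - psC c^-1 * f.
have lt : low 1 t.
  move=> m; rewrite ltnS leqn0 mdeg_eq0 => /eqP->.
  by rewrite pscoefB pscoef_CM mulVf // pscoef1 eqxx subrr.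
have ltX i : low i (t ^+ i) by apply: low1X.
exists (psC c^-1 * psum (fun i => t ^+ i)).
rewrite mulrA [f * _]mulrC -[psC _ * f](subKr 1) -/t.
apply: low_eq => d; apply: (@lowW d.+1 d) => //.
rewrite -[psum _](subrK (\sum_(i < d.+1) t ^+ i)) mulrDr -addrA.
apply: lowD; first by apply: lowMl; apply: psum_low.
rewrite -[1 - t]opprB mulNr -subrX1 opprB addrAC subrr add0r.
by apply: lowN; apply: ltX.
Qed.

Lemma psderivM i f g :
  psderiv i (f * g) = psderiv i f * g + f * psderiv i g.
Proof.
apply/pseriesP => m; pose d := (mdeg m).+2.
have md : (mdeg m < d)%N by rewrite ltnW.
have mUd : (mdeg (m + U_(i))%MM < d)%N by rewrite mdegD mdeg1 addn1.
rewrite -[LHS]/(pscoef (f * g) (m + U_(i))%MM *+ (m i).+1).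
rewrite (pscoefM_trunc _ _ mUd) -mcoeff_deriv mderivM mcoeffD pscoefD.
have tE (h : S) c : (mdeg c <= mdeg m)%N -> (pstrunc d h)@_c = pscoef h c.
  by move=> cm; rewrite mcoeff_pstrunc // ltnW // ltnS ltnS.
have dE (h : S) c : (mdeg c <= mdeg m)%N ->
    (pstrunc d h)^`M(i)@_c = pscoef (psderiv i h) c.
  by move=> cm; rewrite mcoeff_deriv mcoeff_pstrunc // mdegD mdeg1 addn1.
congr (_ + _); symmetry.
  exact: (pscoefM_mpoly (dE f) (tE g)).
exact: (pscoefM_mpoly (tE f) (dE g)).
Qed.

Lemma psderivD i f g : psderiv i (f + g) = psderiv i f + psderiv i g.
Proof. by apply/pseriesP => m; rewrite pscoefD /= mulrnDl. Qed.
Lemma psderiv0 i : psderiv i (0 : S) = 0.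
Proof. by apply/pseriesP => m /=; rewrite mul0rn. Qed.
Lemma low_psderiv d i f : low d.+1 f -> low d (psderiv i f).
Proof. by move=> lf m md /=; rewrite lf ?mul0rn // mdegD mdeg1 addn1. Qed.
Lemma psderivX i j : psderiv i (psX k j) = (i == j)%:R :> S.
Proof.
apply/pseriesP => m /=.
have [->|ij] := eqVneq i j.
  rewrite -[X in _ == X]add0m eqm_add2r pscoef1.
  by case: eqP => [->|_]; rewrite ?mnm0E // mul0rn.
case: eqP => [/mnmP/(_ i)|_]; last by rewrite mul0rn.
by rewrite mnmDE !mnm1E eqxx eq_sym (negbTE ij) addn1.
Qed.

End PowerSeriesTheory.

(** * Submodules and linear algebra over a domain *)

Section Spans.
Variables (R : nzRingType) (M : lmodType R).

(** The closure properties are bundled with the predicate so that the structure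
    of a closed predicate can be inferred for it inside proofs. *)
Record submod_prop := SubmodProp {
  in_submod :> M -> Prop;
  submod_prop0 : in_submod 0;
  submod_propD : forall x y, in_submod x -> in_submod y -> in_submod (x + y);
  submod_propZ : forall r x, in_submod x -> in_submod (r *: x) }.

Definition mem_submod (P : submod_prop) : {pred M} := fun x => `[< P x >].

Fact mem_submod_addr_closed P : Algebra.nmod_closed (mem_submod P).
Proof.
split; first by apply/asboolP; exact: submod_prop0.
by move=> x y /asboolP Px /asboolP Py; apply/asboolP; exact: submod_propD.
Qed.
Fact mem_submod_scaler_closed P : GRing.scaler_closed (mem_submod P).
Proof. by move=> r x /asboolP Px; apply/asboolP; exact: submod_propZ. Qed.
HB.instance Definition _ P :=
  GRing.isAddClosed.Build M (mem_submod P) (mem_submod_addr_closed P).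
HB.instance Definition _ P :=
  GRing.isScaleClosed.Build R M (mem_submod P) (@mem_submod_scaler_closed P).

Definition submod_of (P : submod_prop) : submodClosed M := mem_submod P.

Lemma submod_ofE P x : (x \in submod_of P) = `[< P x >].
Proof. by []. Qed.

Lemma span_ind (A : set M) (P : M -> Prop) :
    P 0 -> (forall x y, P x -> P y -> P (x + y)) ->
    (forall r x, P x -> P (r *: x)) -> (forall a, A a -> P a) ->
  forall x, x \in Defs.span A -> P x.
Proof.
move=> P0 PD PZ AP x /asboolP/(_ (submod_of (SubmodProp P0 PD PZ))) xP.
by apply/asboolP; apply: xP => a Aa; apply/asboolP; apply: AP.
Qed.

Lemma span_mem (A : set M) x : A x -> x \in Defs.span A.
Proof. by move=> Ax; apply/asboolP => N; apply. Qed.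

Lemma span_rangeP d (w : 'I_d -> M) x :
  x \in Defs.span (range w) <-> exists c : 'I_d -> R, x = \sum_j c j *: w j.
Proof.
split=> [|[c ->]]; last first.
  by apply: rpred_sum => j _; rewrite rpredZ // span_mem //; exists j.
apply: (span_ind (P := fun x => exists c : 'I_d -> R, x = \sum_j c j *: w j))
  => [|_ _ [c ->] [c' ->]|r _ [c ->]|_ [j _ <-]].
- by exists (fun=> 0); rewrite big1 // => j _; rewrite scale0r.
- exists (fun j => c j + c' j); rewrite -big_split /=.
  by apply: eq_bigr => j _; rewrite scalerDl.
- exists (fun j => r * c j); rewrite scaler_sumr.
  by apply: eq_bigr => j _; rewrite scalerA.
- exists (fun i => (i == j)%:R); rewrite (bigD1 j) //= eqxx scale1r big1 ?addr0 //.
  by move=> i /negbTE->; rewrite scale0r.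
Qed.

End Spans.

Lemma ideal_gen_rangeP (R : comNzRingType) d (w : 'I_d -> R) x :
  x \in ideal_gen (range w) <-> exists c : 'I_d -> R, x = \sum_j c j * w j.
Proof. exact: (@span_rangeP R R^o). Qed.

Lemma low_ideal_exp n (k : fieldType) e (f : pseries n k) :
  f \in ideal_exp (ps_max n k) e -> low e f.
Proof.
elim: e f => [//|e IH] f; rewrite /ideal_exp iterS.
apply: (@span_ind _ (pseries n k)^o _ (low e.+1)) => [|||_ [a [b [ha hb ->]]]].
- exact: low0.
- exact: lowD.
- by move=> r x lx; apply: lowMl.
- apply: (@lowM _ _ 1 e); last exact: IH.
  apply: (@span_ind _ (pseries n k)^o _ (low 1)) ha => [|||_ [i _ <-]].
  + exact: low0.
  + exact: lowD.
  + by move=> r x lx; apply: lowMl.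
  + exact: low_psX.
Qed.

Section Elimination.
Variables (R : comNzRingType).
Hypothesis dom : forall x y : R, x * y = 0 -> x = 0 \/ y = 0.

Lemma dom_neq0 (x y : R) : x != 0 -> y != 0 -> x * y != 0.
Proof. by move=> x0 y0; apply/eqP => /dom[]/eqP; apply/negP. Qed.

Lemma dom_expf (x : R) i : x != 0 -> x ^+ i != 0.
Proof.
move=> x0; elim: i => [|i IH]; first exact: oner_neq0.
by rewrite exprS dom_neq0.
Qed.

Definition insert_at q (i0 : 'I_q.+1) (x : R) (c : 'I_q -> R) (i : 'I_q.+1) : R :=
  oapp c x (unlift i0 i).

Lemma sum_insert_at q (i0 : 'I_q.+1) x (c : 'I_q -> R) (b : 'I_q.+1 -> R) :
  \sum_i insert_at i0 x c i * b i = x * b i0 + \sum_i c i * b (lift i0 i).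
Proof.
rewrite (bigD1_ord i0) //= /insert_at unlift_none; congr (_ + _).
by apply: eq_bigr => i _; rewrite liftK.
Qed.

(** Gaussian elimination without division: clearing the first coordinate by
    means of one vector whose first coordinate is not zero leaves one vector and
    one coordinate less. *)
Lemma dependent_ord (A : R -> Prop) (A1 : A 1)
    (AB : forall x y, A x -> A y -> A (x - y))
    (AM : forall x y, A x -> A y -> A (x * y))
    e q (v : 'I_q -> 'I_e -> R) : (forall i j, A (v i j)) -> (e < q)%N ->
  exists c : 'I_q -> R, [/\ forall i, A (c i), exists i, c i != 0 &
    forall j, \sum_i c i * v i j = 0].
Proof.
have A0 : A 0 by rewrite -(subrr 1); apply: AB.
have AN x : A x -> A (- x) by rewrite -sub0r; apply: AB.
have AD x y : A x -> A y -> A (x + y).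
  by move=> Ax Ay; rewrite -[y]opprK; apply: AB => //; apply: AN.
elim: e q v => [|e IH] q v Av eq.
  case: q v Av eq => // q v Av _; exists (fun=> 1); split=> //; last by case.
  by exists ord0; rewrite oner_neq0.
have [/existsP[i0 vi0]|] := boolP [exists i, v i ord0 != 0]; last first.
  rewrite negb_exists => /forallP v0.
  have [|c [Ac c0 cv]] := IH q (fun i j => v i (lift ord0 j)) _ (ltnW eq).
    by move=> i j; apply: Av.
  exists c; split=> // j; have [j'|] := unliftP ord0 j; first by move->.
  by move=> ->; rewrite big1 // => i _; move: (v0 i); rewrite negbK => /eqP->; rewrite mulr0.
case: q v Av eq i0 vi0 => // q v Av eq i0 vi0.
pose a := v i0 ord0; pose b i := v (lift i0 i) ord0.
have [|c [Ac [i1 ci1] cv]] := IH q (fun i j =>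
  a * v (lift i0 i) (lift ord0 j) - b i * v i0 (lift ord0 j)) _ eq.
  by move=> i j; apply: AB; apply: AM; apply: Av.
exists (insert_at i0 (- \sum_i c i * b i) (fun i => a * c i)); split.
- move=> i; rewrite /insert_at; case: unliftP => [i'|] _ /=.
    by apply: AM; [apply: Av|].
  apply: AN; elim/big_ind: _ => // i' _.
  by apply: AM; [apply: Ac|apply: Av].
- by exists (lift i0 i1); rewrite /insert_at liftK /= dom_neq0.
- move=> j; rewrite (sum_insert_at i0 _ _ (v^~ j)) mulNr mulr_suml addrC -sumrB.
  have [j' ->|->] := unliftP ord0 j.
    rewrite -[RHS](cv j'); apply: eq_bigr => i _.
    by ring.
  by rewrite big1 // => i _; rewrite -/a -/(b i); ring.
Qed.

Lemma dependent (A : R -> Prop) (A1 : A 1)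
    (AB : forall x y, A x -> A y -> A (x - y))
    (AM : forall x y, A x -> A y -> A (x * y))
    (I J : finType) (v : I -> J -> R) :
    (forall i j, A (v i j)) -> (#|J| < #|I|)%N ->
  exists c : I -> R, [/\ forall i, A (c i), exists i, c i != 0 &
    forall j, \sum_i c i * v i j = 0].
Proof.
move=> Av JI; have [|c [Ac [i0 ci0] cv]] := dependent_ord A1 AB AM
  (v := fun i j => v (enum_val i) (enum_val j)) _ JI; first by [].
exists (fun i => c (enum_rank i)); split=> //.
  by exists (enum_val i0); rewrite enum_valK.
move=> j; rewrite -[RHS](cv (enum_rank j)) (reindex_onto enum_val enum_rank) /=.
  apply: eq_big => [i|i _]; first by rewrite enum_valK eqxx.
  by rewrite enum_valK enum_rankK.
by move=> i _; rewrite enum_rankK.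
Qed.

(** Duality over the field of fractions, with denominators cleared, by the same
    elimination: a relation or a form found after clearing a column with one
    vector extends over that column in a unique way. *)
Lemma span_or_form q e (w : 'I_q -> 'I_e -> R) (a : 'I_e -> R) :
    (exists r c, r != 0 /\ forall i, r * a i = \sum_j c j * w j i) \/
  (exists v : 'I_e -> R,
    (forall j, \sum_i w j i * v i = 0) /\ \sum_i a i * v i != 0).
Proof.
elim: e w a => [|e IH] w a.
  by left; exists 1, (fun=> 0); split; [apply: oner_neq0|case].
have [/existsP[j0 /existsP[i0 w0]]|] := boolP [exists j, exists i, w j i != 0];
    last first.
  rewrite negb_exists => /forallP w0.
  have {}w0 j i : w j i = 0.
    by move: (w0 j); rewrite negb_exists => /forallP/(_ i); rewrite negbK => /eqP.
  have [/existsP[i0 a0]|] := boolP [exists i, a i != 0].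
    right; exists (fun i => (i == i0)%:R); split.
      by move=> j; rewrite big1 // => i _; rewrite w0 mul0r.
    rewrite (bigD1 i0) //= eqxx mulr1 big1 ?addr0 // => i /negbTE->.
    by rewrite mulr0.
  rewrite negb_exists => /forallP a0; left; exists 1, (fun=> 0).
  split=> [|i]; first exact: oner_neq0.
  move: (a0 i); rewrite negbK => /eqP->; rewrite mulr0 big1 // => j _.
  by rewrite mul0r.
pose c0 := w j0 i0.
have [[r [c [r0 rc]]]|[v [vw va]]] := IH
  (fun j l => c0 * w j (lift i0 l) - w j i0 * w j0 (lift i0 l))
  (fun l => c0 * a (lift i0 l) - a i0 * w j0 (lift i0 l)).
  left; pose d := r * a i0 - \sum_j c j * w j i0.
  exists (r * c0), (fun j => c0 * c j + (j == j0)%:R * d).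
  split=> [|i]; first exact: dom_neq0.
  under eq_bigr => j _ do rewrite mulrDl.
  rewrite big_split /= [X in _ + X](bigD1 j0) //= eqxx mul1r.
  rewrite [X in _ + (_ + X)]big1 ?addr0; last first.
    by move=> j /negbTE->; rewrite !mul0r.
  have [l ->|->] := unliftP i0 i.
    apply/eqP; rewrite -subr_eq; apply/eqP.
    have /(congr1 (fun x => x + r * a i0 * w j0 (lift i0 l)
                   - d * w j0 (lift i0 l))) := rc l.
    rewrite mulrBr !mulrA subrK => ->.
    rewrite -addrA -mulrBl /d opprB addrCA subrr addr0 mulr_suml -big_split /=.
    by apply: eq_bigr => j _; rewrite mulrBr !mulrA subrK [c0 * _]mulrC.
  rewrite /d mulrBl -/c0 addrC mulrAC -addrA mulr_suml.
  rewrite [X in _ + X](_ : _ = 0) ?addr0 //.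
  by rewrite addrC -sumrB big1 // => j _; rewrite -/c0; ring.
pose v' := insert_at i0 (- \sum_l w j0 (lift i0 l) * v l) (fun l => c0 * v l).
right; exists v'.
have E (b : 'I_e.+1 -> R) : \sum_i b i * v' i =
    \sum_l (c0 * b (lift i0 l) - b i0 * w j0 (lift i0 l)) * v l.
  under eq_bigr => i _ do rewrite mulrC.
  rewrite sum_insert_at mulNr mulr_suml addrC -sumrB.
  apply: eq_bigr => l _.
  by ring.
by split=> [j|]; rewrite E.
Qed.

End Elimination.

(** * Derivations of a domain *)

Section Derivations.
Variables (R : comNzRingType).
Hypothesis dom : forall x y : R, x * y = 0 -> x = 0 \/ y = 0.

Record derivation (D : R -> R) : Prop := Derivation {
  derD : forall x y, D (x + y) = D x + D y;
  derM : forall x y, D (x * y) = x * D y + y * D x }.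

Section OneDerivation.
Variables (D : R -> R) (hD : derivation D).

Lemma der0 : D 0 = 0.
Proof. by apply: (addrI (D 0)); rewrite -(derD hD) !addr0. Qed.

Lemma der1 : D 1 = 0.
Proof.
by apply: (addrI (D 1)); rewrite addr0 -{3}[1]mulr1 (derM hD) mul1r.
Qed.

Lemma derX x i : D (x ^+ i) = i%:R * x ^+ i.-1 * D x.
Proof.
elim: i => [|[|i] IH]; first by rewrite der1 !mul0r.
  by rewrite expr1 expr0 !mul1r.
by rewrite exprS (derM hD) IH /= exprS [i.+2%:R]mulrSr; ring.
Qed.

Lemma der_horner (p : {poly R}) x : (forall i, D p`_i = 0) ->
  D p.[x] = p^`().[x] * D x.
Proof.
move=> Dp; rewrite horner_coef.
rewrite (big_morph D (derD hD) der0) horner_poly mulr_suml.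
case: (size p) => [|d]; first by rewrite !big_ord0.
rewrite big_ord_recl /= expr0 mulr1 Dp add0r.
apply: eq_bigr => i _; rewrite /bump leq0n add1n (derM hD) Dp mulr0 addr0 derX /=.
by rewrite -[in RHS]mulr_natr !mulrA.
Qed.

(** The derivative of an equation of [x] over the constants is a shorter
    equation, unless [D x] vanishes. *)
Lemma der_algebraic (B : R -> Prop) (BD : forall x, B x -> D x = 0)
    (Bnat : forall x i, B x -> B (x *+ i)) d (p : {poly R}) x :
    (forall i, (0 < i < d)%N -> i%:R != 0 :> R) ->
    (forall i, B p`_i) -> (size p <= d)%N -> p != 0 -> p.[x] = 0 -> D x = 0.
Proof.
move=> dn; move: {2}(size p) (leqnn (size p)) => N.
elim: N p => [|N IH] p sp Bp spd p0 px.
  by move: sp; rewrite leqn0 size_poly_eq0 (negbTE p0).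
have /dom[px'|//] : p^`().[x] * D x = 0.
  by rewrite -der_horner ?px ?der0 // => i; apply: BD.
have [p'0|p'0] := eqVneq p^`() 0; last first.
  apply: IH px' => //; first by rewrite -ltnS; apply: leq_trans (lt_size_deriv p0) sp.
    by move=> i; rewrite coef_deriv; apply: Bnat.
  by apply: leq_trans spd; apply: ltnW; apply: lt_size_deriv.
have pC i : p`_i.+1 = 0.
  have [id|id] := ltnP i.+1 d; last by rewrite nth_default // (leq_trans spd).
  have := congr1 (fun q : {poly R} => q`_i) p'0.
  rewrite coef_deriv coef0 -mulr_natr => /dom[//|/eqP].
  by rewrite (negbTE (dn _ _)).
have pE : p = (p`_0)%:P by apply/polyP => -[|i]; rewrite coefC //= pC.
by move: p0; rewrite pE -[p`_0](hornerC _ x) -pE px eqxx.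
Qed.

End OneDerivation.

(** ** Characteristic p: the degree of a domain over its p-th powers *)

Section FrobeniusRank.
Variables (p : nat) (charRp : p \in [pchar R]).
Variables (A : R -> Prop) (t : R) (M : nat).
Hypotheses (A1 : A 1) (AB : forall x y, A x -> A y -> A (x - y))
  (AM : forall x y, A x -> A y -> A (x * y)).
Hypothesis AtX : forall a, A a -> exists c : 'I_p -> R,
  (forall l, A (c l)) /\ a = \sum_l c l ^+ p * t ^+ l.

Definition independent q (b : 'I_q -> R) :=
  forall c : 'I_q -> R, (forall i, A (c i)) -> \sum_i c i * b i = 0 ->
  forall i, c i = 0.

Hypothesis rankM : forall q (b : 'I_q -> R), independent b -> (q <= M)%N.

Let A0 : A 0. Proof. by rewrite -(subrr 1); apply: AB. Qed.
Let AN x : A x -> A (- x). Proof. by rewrite -sub0r; apply: AB. Qed.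
Let AX x i : A x -> A (x ^+ i).
Proof. by move=> Ax; elim: i => [//|i IH]; rewrite exprS; apply: AM. Qed.

Lemma sub_pchar (x y : R) : (x - y) ^+ p = x ^+ p - y ^+ p.
Proof. exact: (rmorphB (pFrobenius_aut charRp)). Qed.

Lemma sum_pchar (T : Type) (r : seq T) (F : T -> R) :
  (\sum_(i <- r) F i) ^+ p = \sum_(i <- r) F i ^+ p.
Proof. exact: (rmorph_sum (pFrobenius_aut charRp)). Qed.

Lemma maximal_independent : exists e (b : 'I_e -> R),
  [/\ (0 < e)%N, independent b & forall r, exists a c,
     [/\ A a, a != 0, forall j, A (c j) & a * r = \sum_j c j * b j]].
Proof.
pose P q := `[< exists b : 'I_q -> R, independent b >].
have P1 : P 1%N.
  apply/asboolP; exists (fun=> 1) => c _; rewrite big_ord_recl big_ord0 addr0 mulr1.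
  by move=> c0 i; rewrite ord1.
have PM q : P q -> (q <= M)%N by move=> /asboolP[b] /rankM.
have [e /asboolP[b bI] emax] := ex_maxnP (ex_intro (fun q => is_true (P q)) _ P1) PM.
exists e, b; split=> //; first exact: emax.
move=> r; apply: contrapT => nr.
have /emax : P e.+1; last by rewrite ltnn.
apply/asboolP; exists (insert_at ord_max r b) => c Ac.
under eq_bigr => i _ do rewrite mulrC.
rewrite sum_insert_at addrC => cb.
have [c0|c0] := eqVneq (c ord_max) 0; last first.
  case: nr; exists (c ord_max), (fun j => - c (lift ord_max j)).
  split=> // [j|]; first exact: AN.
  under eq_bigr => j _ do rewrite mulNr mulrC.
  by rewrite sumrN mulrC; apply/eqP; rewrite -addr_eq0 addrC cb.
move=> i; have [j ->|->//] := unliftP ord_max i.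
apply: (bI (fun j => c (lift ord_max j))) => //.
rewrite c0 mulr0 addr0 in cb; rewrite -[RHS]cb.
by apply: eq_bigr => l _; rewrite mulrC.
Qed.

(** The fraction field has the same degree over that of [A] as the field of
    [p]-th powers over that of the [p]-th powers of [A]; as [A] has degree at
    most [p] over its [p]-th powers, so does the fraction field over its own. *)
Lemma dependent_pth_powers (v : 'I_p.+1 -> R) :
  exists c : 'I_p.+1 -> R, (exists i, c i != 0) /\ \sum_i c i ^+ p * v i = 0.
Proof.
have p_pr := pcharf_prime charRp.
have p_gt0 : (0 < p)%N := prime_gt0 p_pr.
have [e [b [e_gt0 bI bgen]]] := maximal_independent.
pose T := ('I_p.+1 * 'I_e)%type.
pose w (x : T) := v x.1 * b x.2 ^+ p.
have /choice[a /choice[c ac]] : forall x : T, exists a, exists c : 'I_e * 'I_p -> R,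
    [/\ A a, a != 0, forall y, A (c y) &
        a ^+ p * w x = \sum_y c y ^+ p * (b y.1 * t ^+ y.2)].
  move=> x; have [a [c [Aa a0 Ac acE]]] := bgen (w x).
  have /choice[d dE] : forall j, exists d : 'I_p -> R, (forall l, A (d l)) /\
      a ^+ p.-1 * c j = \sum_l d l ^+ p * t ^+ l.
    by move=> j; apply: AtX; apply: AM => //; apply: AX.
  exists a, (fun y => d y.1 y.2); split=> // [y|]; first by case: (dE y.1).
  have -> : a ^+ p = a ^+ p.-1 * a by rewrite -exprSr prednK.
  rewrite -mulrA acE mulr_sumr.
  rewrite -(pair_bigA _ (fun j l => d j l ^+ p * (b j * t ^+ l))) /=.
  apply: eq_bigr => j _; rewrite mulrA; case: (dE j) => _ ->.
  by rewrite mulr_suml; apply: eq_bigr => l _; rewrite mulrAC mulrA.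
pose A' x := exists2 y, A y & x = y ^+ p.
have A'1 : A' 1 by exists 1; rewrite ?expr1n.
have A'B x y : A' x -> A' y -> A' (x - y).
  move=> [x' Ax ->] [y' Ay ->]; exists (x' - y'); first exact: AB.
  by rewrite sub_pchar.
have A'M x y : A' x -> A' y -> A' (x * y).
  move=> [x' Ax ->] [y' Ay ->]; exists (x' * y'); first exact: AM.
  by rewrite exprMn.
have [||g [Ag [x0 gx0] gE]] := dependent dom A'1 A'B A'M
  (v := fun (x : T) y => c x y ^+ p).
- by move=> x y; exists (c x y) => //; case: (ac x).
- by rewrite !card_prod !card_ord mulnC ltn_pmul2r.
have /choice[h hE] : forall x, exists h, A h /\ g x = h ^+ p.
  by move=> x; have [h Ah ->] := Ag x; exists h.
pose d i := \sum_j h (i, j) * a (i, j) * b j.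
exists d; split.
  exists x0.1; apply/eqP => d0.
  have h0 : h x0 != 0.
    by apply: contra gx0 => /eqP h0; case: (hE x0) => _ ->; rewrite h0 expr0n; case: p p_gt0.
  have : h x0 * a x0 != 0 by apply: dom_neq0 => //; case: (ac x0).
  case: x0 d0 {gx0 h0} => i0 j0 /= d0 /eqP[].
  apply: (bI (fun j => h (i0, j) * a (i0, j))) d0 j0 => j.
  by apply: AM; [case: (hE (i0, j))|case: (ac (i0, j))].
transitivity (\sum_x g x * (a x ^+ p * w x)).
  rewrite (eq_bigr (fun x => g (x.1, x.2) * (a (x.1, x.2) ^+ p * w (x.1, x.2))));
    last by case.
  rewrite -(pair_bigA _ (fun i j => g (i, j) * (a (i, j) ^+ p * w (i, j)))) /=.
  apply: eq_bigr => i _; rewrite sum_pchar mulr_suml.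
  apply: eq_bigr => j _; rewrite !exprMn /w /=; case: (hE (i, j)) => _ ->.
  by ring.
under eq_bigr => x _.
  have [_ _ _ ->] := ac x; rewrite mulr_sumr.
  under eq_bigr => y _ do rewrite mulrA.
  over.
rewrite exchange_big big1 //= => y _; rewrite -mulr_suml gE mul0r //.
Qed.

End FrobeniusRank.

End Derivations.

(** * Prime ideals *)

Section Primes.
Variable R : comNzRingType.

Record prime_prop := PrimeProp {
  in_prime :> R -> Prop;
  prime_prop0 : in_prime 0;
  prime_propB : forall x y, in_prime x -> in_prime y -> in_prime (x - y);
  prime_propM : forall r x, in_prime x -> in_prime (r * x);
  prime_prop1 : ~ in_prime 1;
  prime_propP : forall x y, in_prime (x * y) -> in_prime x \/ in_prime y }.

Definition mem_prime (P : prime_prop) : {pred R} := fun x => `[< P x >].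

Fact mem_prime_idealr_closed P : idealr_closed (mem_prime P).
Proof.
split; first by apply/asboolP; exact: prime_prop0.
  by apply/negP => /asboolP; exact: prime_prop1.
move=> a u v /asboolP Pu /asboolP Pv; apply/asboolP.
rewrite -[v]opprK; apply: prime_propB; first exact: prime_propM.
by rewrite -sub0r; apply: prime_propB => //; apply: prime_prop0.
Qed.
Fact mem_prime_prime_closed P : prime_idealr_closed (mem_prime P).
Proof.
move=> u v /asboolP /prime_propP[Pu|Pv]; apply/orP; [left|right]; exact/asboolP.
Qed.
HB.instance Definition _ P := isIdealr.Build R (mem_prime P)
  (mem_prime_idealr_closed P).
HB.instance Definition _ P := isPrimeIdealrClosed.Build R (mem_prime P)
  (@mem_prime_prime_closed P).
Definition prime_of (P : prime_prop) : prime_idealr R := mem_prime P.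

Lemma prime_ofP (P : prime_prop) (x : R) : reflect (P x) (x \in prime_of P).
Proof. exact: asboolP. Qed.

(** An ideal that is maximal among those that contain no power of [y] is prime:
    if [u] and [v] are not in it, powers of [y] lie in the ideals obtained by
    adding [u] and [v], and their product is in that obtained by adding [u * v]. *)
Lemma prime_avoiding (J : R -> Prop) (y : R) :
    J 0 -> (forall x z, J x -> J z -> J (x - z)) ->
    (forall r x, J x -> J (r * x)) -> (forall i, ~ J (y ^+ i)) ->
  exists P : prime_prop, (forall x, J x -> P x) /\ forall i, ~ P (y ^+ i).
Proof.
move=> J0 JB JM Jy.
pose F : set (set R) := [set Q : set R | [/\ J `<=` Q,
  forall x z, Q x -> Q z -> Q (x - z), forall r x, Q x -> Q (r * x) &
  forall i, ~ Q (y ^+ i)] \/ Q = set0].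
have Fchain C : C `<=` F -> total_on C subset -> F (\bigcup_(X in C) X).
  move=> CF Ctot.
  have [[Q0 CQ0 Q00]|nC] := pselect (exists2 Q, C Q & Q !=set0); last first.
    right; apply/seteqP; split=> // x [Q CQ Qx]; apply: nC; exists Q => //.
    by exists x.
  have good Q : C Q -> Q !=set0 -> [/\ J `<=` Q,
      forall x z, Q x -> Q z -> Q (x - z), forall r x, Q x -> Q (r * x) &
      forall i, ~ Q (y ^+ i)].
    by move=> CQ [x Qx]; case: (CF _ CQ) => // Q0'; move: Qx; rewrite Q0'.
  left; split.
  - by move=> x Jx; exists Q0 => //; case: (good _ CQ0 Q00) => JQ _ _ _; apply: JQ.
  - move=> x z [Q1 CQ1 Q1x] [Q2 CQ2 Q2z].
    have [Q12|Q21] := Ctot _ _ CQ1 CQ2.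
      exists Q2 => //; case: (good Q2 CQ2); first by exists z.
      by move=> _ QB _ _; apply: QB => //; apply: Q12.
    exists Q1 => //; case: (good Q1 CQ1); first by exists x.
    by move=> _ QB _ _; apply: QB => //; apply: Q21.
  - move=> r x [Q1 CQ1 Q1x]; exists Q1 => //; case: (good Q1 CQ1); first by exists x.
    by move=> _ _ QM _; apply: QM.
  - move=> i [Q1 CQ1 Q1x]; case: (good Q1 CQ1); first by exists (y ^+ i).
    by move=> _ _ _ /(_ i).
have [Q [FQ Qmax]] := Zorn_bigcup Fchain.
have [JQ QB QM Qy] : [/\ J `<=` Q,
  forall x z, Q x -> Q z -> Q (x - z), forall r x, Q x -> Q (r * x) &
  forall i, ~ Q (y ^+ i)].
  case: FQ => // Q0; suff /(_ (or_introl _)) : ~ F J by case; split.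
  by apply: Qmax; rewrite Q0; split=> // /(_ 0 J0).
have Q0 : Q 0 by apply: JQ.
have QD x z : Q x -> Q z -> Q (x + z).
  by move=> Qx Qz; rewrite -[z]opprK; apply: (QB) => //; rewrite -sub0r; apply: (QB).
have ext u : ~ Q u -> exists i q r, Q q /\ y ^+ i = q + r * u.
  move=> Qu; apply: contrapT => nex.
  pose Q' : set R := [set x | exists q r, Q q /\ x = q + r * u].
  suff nF : ~ F Q'; last first.
    apply: Qmax; split=> [x Qx|/(_ u) h].
      by exists x, 0; rewrite mul0r addr0.
    by apply/Qu/h; exists 0, 1; split=> //; rewrite add0r mul1r.
  apply: nF; left; split.
  - by move=> x Jx; exists x, 0; split; [apply: JQ|rewrite mul0r addr0].
  - move=> _ _ [q [r [Qq ->]]] [q' [r' [Qq' ->]]]; exists (q - q'), (r - r').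
    by split; [apply: (QB)|ring].
  - move=> s _ [q [r [Qq ->]]]; exists (s * q), (s * r).
    by split; [apply: (QM)|ring].
  - by move=> i [q [r [Qq yE]]]; apply: nex; exists i, q, r.
have Q1 : ~ Q 1 by rewrite -(expr0 y); apply: Qy.
have QP x z : Q (x * z) -> Q x \/ Q z.
  move=> Qxz; have [?|/ext[i [q [r [Qq yi]]]]] := pselect (Q x); first by left.
  have [?|/ext[j [q' [r' [Qq' yj]]]]] := pselect (Q z); first by right.
  case: (Qy (i + j)%N); rewrite exprD yi yj.
  rewrite [X in Q X](_ : _ = (q' + r' * z) * q + (r * x * q' + r * r' * (x * z))).
    by apply: (QD); [apply: (QM)|apply: (QD); apply: (QM)].
  by ring.
by exists (PrimeProp Q0 QB QM Q1 QP).
Qed.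

End Primes.

(** * One-dimensional quotients of the power series ring *)

Section Quotient.
Variables (n : nat) (k : fieldType) (I : idealr (pseries n k)).
Local Notation S := (pseries n k).
Local Notation R := {ideal_quot I}.

Definition proj (f : S) : R := (\pi_R f)%qT.

Fact proj_is_zmod : zmod_morphism proj.
Proof. exact: (rmorphB (\pi_R)%qT). Qed.
Fact proj_is_monoid : monoid_morphism proj.
Proof. by split; [apply: (rmorph1 (\pi_R)%qT)|apply: (rmorphM (\pi_R)%qT)]. Qed.
HB.instance Definition _ := GRing.isZmodMorphism.Build S R proj proj_is_zmod.
HB.instance Definition _ := GRing.isMonoidMorphism.Build S R proj proj_is_monoid.

Lemma projD f g : proj (f + g) = proj f + proj g. Proof. exact: rmorphD. Qed.
Lemma projB f g : proj (f - g) = proj f - proj g. Proof. exact: rmorphB. Qed.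
Lemma projM f g : proj (f * g) = proj f * proj g. Proof. exact: rmorphM. Qed.
Lemma projX f i : proj (f ^+ i) = proj f ^+ i. Proof. exact: rmorphXn. Qed.
Lemma proj0 : proj 0 = 0. Proof. exact: rmorph0. Qed.
Lemma proj1 : proj 1 = 1. Proof. exact: rmorph1. Qed.
Lemma proj_sum (T : Type) (r : seq T) (P : pred T) (F : T -> S) :
  proj (\sum_(i <- r | P i) F i) = \sum_(i <- r | P i) proj (F i).
Proof. exact: rmorph_sum. Qed.

Lemma proj_eq f g : proj f = proj g <-> f - g \in I.
Proof.
rewrite (Quotient.idealrBE I); split=> [fg|/eqP//]; exact/eqP.
Qed.

Lemma proj_eq0 f : proj f = 0 <-> f \in I.
Proof. by rewrite -proj0 proj_eq subr0. Qed.

Lemma proj_surj (r : R) : exists f, r = proj f.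
Proof. by exists (repr r); rewrite /proj reprK. Qed.

Hypothesis Ilow : forall f, f \in I -> low 2 f.
Hypothesis dom : forall x y : R, x * y = 0 -> x = 0 \/ y = 0.

Lemma I_const0 f : f \in I -> pscoef f 0%MM = 0.
Proof. by move=> fI; apply: (Ilow fI); rewrite mdeg0. Qed.

Definition in_max (r : R) := exists2 g, pscoef g 0%MM = 0 & r = proj g.

Lemma in_maxE f : in_max (proj f) -> pscoef f 0%MM = 0.
Proof.
by move=> [g g0 /proj_eq/I_const0]; rewrite pscoefB g0 subr0.
Qed.

Lemma proj_unit f : pscoef f 0%MM != 0 -> exists g, proj f * proj g = 1.
Proof.
by move=> /ps_unit[g fg]; exists g; rewrite -projM fg proj1.
Qed.

Definition max_prime : prime_prop R.
Proof.
refine (@PrimeProp R in_max _ _ _ _ _).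
- by exists 0; rewrite ?proj0.
- move=> _ _ [f f0 ->] [g g0 ->]; exists (f - g); last by rewrite projB.
  by rewrite pscoefB f0 g0 subrr.
- move=> r _ [f f0 ->]; have [g ->] := proj_surj r.
  by exists (g * f); rewrite ?projM // pscoefM0 f0 mulr0.
- by rewrite -proj1 => /in_maxE/eqP; rewrite pscoef1 eqxx oner_eq0.
- move=> x y; have [f ->] := proj_surj x; have [g ->] := proj_surj y.
  rewrite -projM => /in_maxE/eqP; rewrite pscoefM0 mulf_eq0.
  by case/orP => /eqP h0; [left; exists f|right; exists g].
Defined.

Definition zero_prime : prime_prop R.
Proof.
refine (@PrimeProp R (fun r => r = 0) _ _ _ _ dom) => //.
- by move=> x y -> ->; rewrite subrr.
- by move=> r x ->; rewrite mulr0.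
- by move=> /eqP; rewrite oner_eq0.
Defined.

(** A prime ideal that contains [t] but no power of [x] would lie strictly
    between zero and the maximal ideal. *)
Lemma power_mod (hdim : forall l, prime_chain R l -> (l <= 1)%N) t x :
  t \notin I -> pscoef x 0%MM = 0 -> exists N h, proj (x ^+ N) = proj (h * t).
Proof.
move=> tI x0; apply: contrapT => nx.
have t0 : proj t <> 0 by move=> /proj_eq0; apply/negP.
pose J (r : R) := exists h, r = proj (h * t).
have [||||P [JP Px]] := @prime_avoiding R J (proj x).
- by exists 0; rewrite mul0r proj0.
- by move=> _ _ [h ->] [h' ->]; exists (h - h'); rewrite -projB mulrBl.
- move=> r _ [h ->]; have [g ->] := proj_surj r.
  by exists (g * h); rewrite -mulrA !projM.
- by move=> i [h xh]; apply: nx; exists i, h; rewrite projX.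
have Pm r : P r -> in_max r.
  have [f ->] := proj_surj r => Pf; exists f => //; apply/eqP/negP => /negP f0.
  have [g fg] := proj_unit f0; apply: (prime_prop1 (p := P)).
  by rewrite -fg mulrC; apply: prime_propM.
suff /hdim : prime_chain R 2 by [].
exists (fun i => match i with
  | 0%N => prime_of zero_prime | 1%N => prime_of P | _ => prime_of max_prime end).
move=> [|[|//]] _; split.
- by move=> r /prime_ofP->; apply/prime_ofP; apply: prime_prop0.
- move=> /(_ (proj t)) h; apply: t0; apply/(@prime_ofP _ zero_prime)/h/prime_ofP.
  by apply: JP; exists 1; rewrite mul1r.
- by move=> r /prime_ofP Pr; apply/prime_ofP; apply: Pm.
- move=> /(_ (proj x)) h; apply: (Px 1%N); rewrite expr1.
  by apply/prime_ofP/h/prime_ofP; exists x.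
Qed.

(** A monomial of large degree is divisible by a large power of some variable,
    and that power is a multiple of [t] modulo [I]. *)
Lemma max_power_mod (hdim : forall l, prime_chain R l -> (l <= 1)%N) t :
  t \notin I -> exists N, forall f, low N f -> exists h, proj f = proj (h * t).
Proof.
move=> tI.
have /choice[N /choice[h hE]] : forall i : 'I_n, exists N h,
    proj (psX k i ^+ N) = proj (h * t).
  by move=> i; apply: power_mod => //; apply: (@low_psX _ _ i); rewrite mdeg0.
pose d := (\sum_i N i).+1; exists d.
apply: (@low_ideal _ _ (fun f => exists h, proj f = proj (h * t))).
- by exists 0; rewrite mul0r.
- move=> f g [f' ff'] [g' gg']; exists (f' + g').
  by rewrite mulrDl !projD ff' gg'.
- by move=> f g [g' gg']; exists (f * g'); rewrite -mulrA projM gg' -projM.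
move=> a ad.
have [i Ni] : exists i, (N i <= a i)%N.
  apply/existsP; rewrite -[X in is_true X]negbK negb_exists; apply/negP => /forallP aN.
  suff : (mdeg a <= \sum_i N i)%N by rewrite ad ltnn.
  rewrite mdegE.
  by apply: leq_sum => i _; move: (aN i); rewrite -ltnNge; apply: ltnW.
exists (psXm k (a - U_(i) *+ N i)%MM * h i).
rewrite -mulrA projM -hE psX_psXm psXmX -projM psXmM submK //.
apply/mnm_lepP => j; rewrite mulmnE mnm1E.
by case: eqP => [<-|_]; rewrite ?mul1n.
Qed.

End Quotient.

(** ** Power series in one of the variables *)

Section OneVariable.
Variables (n : nat) (k : fieldType) (i0 : 'I_n).
Local Notation S := (pseries n k).
Local Notation t := (psX k i0).

(** The series in the [d]-th power of the variable [i0], given by their support so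
    that no convergence is involved in sums and products. *)
Definition pser d (g : S) :=
  forall m, pscoef g m != 0 -> exists j, m = (U_(i0) *+ (d * j))%MM.

Lemma pserB d f g : pser d f -> pser d g -> pser d (f - g).
Proof.
move=> pf pg m; rewrite pscoefB; have [/eqP f0|/pf//] := boolP (pscoef f m == 0).
by rewrite f0 sub0r oppr_eq0; apply: pg.
Qed.
Lemma pserM d f g : pser d f -> pser d g -> pser d (f * g).
Proof.
move=> pf pg m fgm; apply: contrapT => nm; move/eqP: fgm; apply.
rewrite pscoefM big1 // => -[[a ha] [b hb]] /= /eqP mE.
have [f0|/pf[j aE]] := eqVneq (pscoef f a) 0; first by rewrite f0 mul0r.
have [g0|/pg[l bE]] := eqVneq (pscoef g b) 0; first by rewrite g0 mulr0.
case: nm; exists (j + l)%N; rewrite mE aE bE.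
by apply/mnmP => i; rewrite mnmDE !mulmnE mulnDr mulnDr.
Qed.
Lemma pserC d c : pser d (psC n c).
Proof.
move=> m /=; have [->|_] := eqVneq m 0%MM; last by rewrite eqxx.
by move=> _; exists 0%N; rewrite muln0 mulm0n.
Qed.
Lemma pser1 d : pser d 1. Proof. by rewrite -psC1; apply: pserC. Qed.
Lemma pserXm d j : pser d (psXm k (U_(i0) *+ (d * j))%MM).
Proof.
by move=> m /=; have [->|_] := eqVneq m (U_(i0) *+ (d * j))%MM;
  [exists j|rewrite eqxx].
Qed.
Lemma pserX j : pser 1 (t ^+ j).
Proof. by rewrite psX_psXm psXmX -{1}[j]mul1n; apply: pserXm. Qed.
Lemma pser_psum d F : (forall i, pser d (F i)) -> pser d (psum F).
Proof.
move=> pF m Fm; apply: contrapT => nm; move/eqP: Fm; apply.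
rewrite /= big1 // => i _; have [//|/pF h] := eqVneq (pscoef (F i) m) 0.
by case: nm.
Qed.

Lemma pser_expand e d g : (0 < e)%N -> pser e g ->
  low d (g - \sum_(i < d) psC n (pscoef g (U_(i0) *+ (e * i))%MM)
                          * psXm k (U_(i0) *+ (e * i))%MM).
Proof.
move=> e0 pg m md; rewrite pscoefB pscoef_sum.
under eq_bigr => i _ do rewrite pscoef_CM pscoef_psXm.
have [gm0|/pg[j mE]] := eqVneq (pscoef g m) 0.
  rewrite gm0 big1 ?subr0 // => i _.
  by case: (eqVneq m _) => [<-|]; rewrite ?gm0 ?mul0r ?mulr0.
have inj a b : (U_(i0) *+ (e * a))%MM = (U_(i0) *+ (e * b))%MM -> a = b.
  move=> /mnmP/(_ i0); rewrite !mulmnE mnm1E eqxx !mul1n => /eqP.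
  by rewrite eqn_pmul2l // => /eqP.
have jd : (j < d)%N.
  apply: leq_ltn_trans md; rewrite mE mdegMn mdeg1 mul1n.
  by rewrite -{1}[j]mul1n leq_mul2r e0 orbT.
rewrite (bigD1 (Ordinal jd)) //= -mE eqxx mulr1 big1 ?addr0 ?subrr // => i ij.
case: eqP => [|_]; last by rewrite mulr0.
by rewrite mE => /inj ji; move: ij; rewrite -val_eqE /= ji eqxx.
Qed.

Lemma pser_psderiv d g i : i != i0 -> pser d g -> psderiv i g = 0.
Proof.
move=> ii pg; apply/pseriesP => m /=.
have [->|/pg[j /mnmP/(_ i)]] := eqVneq (pscoef g (m + U_(i))%MM) 0.
  by rewrite mul0rn.
by rewrite mnmDE mulmnE !mnm1E eqxx eq_sym (negbTE ii) addn1.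
Qed.

Section Frobenius.
Variable p : nat.
Hypotheses (chark : p \in [pchar k]) (hk : perfect_field k).

Let p_gt0 : (0 < p)%N. Proof. exact: prime_gt0 (pcharf_prime chark). Qed.

Lemma pchar_ps : p \in [pchar S].
Proof.
apply/andP; split; first exact: (pcharf_prime chark).
apply/eqP/pseriesP => m; rewrite pscoefMn pscoef0 pscoef1.
by case: (m == 0%MM); rewrite ?mul0rn // (pcharf0 chark).
Qed.

(** The coefficients have [p]-th roots as the field is perfect, and the Frobenius
    map commutes with infinite sums. *)
Lemma pser_pth_power g : pser p g -> exists2 h, pser 1 h & g = h ^+ p.
Proof.
move=> pg; have /choice[c cE] j := hk chark (pscoef g (U_(i0) *+ (p * j))%MM).
pose F i := psC n (c i) * t ^+ i.
have lF i : low i (F i) by apply: lowMl; apply: low1X; apply: low_psX.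
exists (psum F).
  by apply: pser_psum => i; apply: pserM; [apply: pserC|apply: pserX].
apply: low_eq => d; have h := psum_low lF (d := d).
rewrite -[psum F](subrK (\sum_(i < d) F i)).
have FrobD (x y : S) : (x + y) ^+ p = x ^+ p + y ^+ p.
  exact: (rmorphD (pFrobenius_aut pchar_ps)).
have FrobS (r : seq 'I_d) (G : 'I_d -> S) :
    (\sum_(i <- r) G i) ^+ p = \sum_(i <- r) G i ^+ p.
  exact: (rmorph_sum (pFrobenius_aut pchar_ps)).
rewrite FrobD FrobS opprD addrC -addrA; apply: lowD.
  apply: lowN; apply: (lowW _ (lowX (i := p) h)).
  by rewrite -{1}[d]muln1 leq_mul2l p_gt0 orbT.
rewrite addrC.
have -> : \sum_(i < d) F i ^+ p = \sum_(i < d)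
    psC n (pscoef g (U_(i0) *+ (p * i))%MM) * psXm k (U_(i0) *+ (p * i))%MM.
  apply: eq_bigr => i _; rewrite exprMn -exprM mulnC psX_psXm psXmX -cE.
  congr (_ * _); elim: (p) => [|q IH]; first by rewrite !expr0.
  by rewrite !exprS psCM IH.
exact: pser_expand.
Qed.

Lemma pser_split a : pser 1 a ->
  exists c : 'I_p -> S, (forall l, pser p (c l)) /\ a = \sum_l c l * t ^+ l.
Proof.
move=> pa.
pose c (l : 'I_p) : S := PSeries (fun m =>
  if (m == (U_(i0) *+ m i0)%MM) && (p %| m i0)%N
  then pscoef a (m + U_(i0) *+ l)%MM else 0).
exists c; split.
  move=> l m /=; case: ifP => [/andP[/eqP mE /dvdnP[j mj]] _|]; last by rewrite eqxx.
  by exists j; rewrite mE mj mulnC.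
apply/pseriesP => m; rewrite pscoef_sum.
under eq_bigr => l _ do rewrite mulrC psX_psXm psXmX pscoef_psXmM.
have Ui j : (U_(i0) *+ j)%MM i0 = j by rewrite mulmnE mnm1E eqxx mul1n.
have [am0|/pa[j]] := eqVneq (pscoef a m) 0.
  rewrite am0 big1 // => l _; case: ifP => //= lm.
  by case: ifP => // _; rewrite submK.
rewrite mul1n => mE.
have jp : (j %% p < p)%N by rewrite ltn_mod.
have Ule l : (U_(i0) *+ l <= U_(i0) *+ j)%MM = (l <= j)%N.
  apply/mnm_lepP/idP => [/(_ i0)|lj i]; first by rewrite !Ui.
  by rewrite !mulmnE leq_mul2l lj orbT.
have UB l : (U_(i0) *+ j - U_(i0) *+ l)%MM = (U_(i0) *+ (j - l))%MM.
  by apply/mnmP => i; rewrite mnmBE !mulmnE mulnBr.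
rewrite (bigD1 (Ordinal jp)) //= big1 ?addr0.
  rewrite mE Ule leq_mod UB Ui eqxx /= {2}(divn_eq j p) addnK dvdn_mull //=.
  by rewrite -UB submK // Ule leq_mod.
move=> l lj; rewrite mE Ule; case: ifP => // lej.
rewrite UB Ui eqxx /=; case: ifP => // /dvdnP[q qE].
case/eqP: lj; apply: val_inj => /=.
by rewrite -(subnK lej) qE modnMDl modn_small.
Qed.

End Frobenius.
End OneVariable.

(** * The rank of the module of derivations *)

Section Rank.
Variables (n : nat) (k : fieldType) (I : idealr (pseries n k)).
Local Notation S := (pseries n k).
Local Notation R := {ideal_quot I}.
Local Notation proj := (proj I).
Variables (m : nat) (f : 'I_m -> S).
Hypothesis hf : I =i ideal_gen (range f).
Hypothesis Ilow : forall f, f \in I -> low 2 f.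
Hypothesis dom : forall x y : R, x * y = 0 -> x = 0 \/ y = 0.
Hypothesis hdim : forall l, prime_chain R l -> (l <= 1)%N.
Hypothesis hk : perfect_field k.

Lemma mem_I g : g \in I <-> exists c : 'I_m -> S, g = \sum_j c j * f j.
Proof. by rewrite hf; apply: ideal_gen_rangeP. Qed.

Section Fix.
Variable i0 : 'I_n.
Local Notation t := (psX k i0).

Lemma psX_notin_I : t \notin I.
Proof.
apply/negP => /Ilow/(_ U_(i0)%MM); rewrite mdeg1 => /(_ isT) /=.
by rewrite eqxx => /eqP; rewrite oner_eq0.
Qed.

Definition one_var (r : R) := exists2 g, pser i0 1 g & r = proj g.

Lemma one_var1 : one_var 1.
Proof. by exists 1; [apply: pser1|rewrite proj1]. Qed.
Lemma one_varB x y : one_var x -> one_var y -> one_var (x - y).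
Proof.
move=> [g pg ->] [h ph ->].
by exists (g - h); [apply: pserB|rewrite projB].
Qed.
Lemma one_varM x y : one_var x -> one_var y -> one_var (x * y).
Proof.
move=> [g pg ->] [h ph ->].
by exists (g * h); [apply: pserM|rewrite projM].
Qed.

(** Successive division by [t]: writing [g] as a polynomial of bounded degree
    plus a multiple of [t] plus an element of [I], and so on with the cofactor
    of [t], yields two convergent series. As [I] is finitely generated, the sum
    of the parts in [I] stays in [I]. *)
Lemma finite_over_one_var : exists N, forall r : R,
  exists a : 'X_{1..n < N} -> R,
    (forall al, one_var (a al)) /\ r = \sum_al a al * proj (psXm k al).
Proof.
have [N hN] := max_power_mod Ilow dom hdim psX_notin_I; exists N.
(* The terms of degree less than [N]; the other ones form a multiple of [t]
   modulo [I]. *)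
pose P (g : S) := \sum_(al : 'X_{1..n < N}) psC n (pscoef g al) * psXm k al.
have lP g : low N (g - P g).
  move=> a ad; rewrite pscoefB pscoef_sum.
  under eq_bigr => b _ do rewrite pscoef_CM pscoef_psXm.
  rewrite (bigD1 (BMultinom ad)) //= eqxx mulr1 opprD addrA subrr add0r.
  rewrite big1 ?oppr0 // => b ba.
  rewrite [a == b](_ : _ = false) ?mulr0 //; apply/negbTE.
  by rewrite eq_sym; apply: contra ba => /eqP bE; apply/eqP/val_inj.
have /choice[nxt /choice[s hs]] : forall g, exists h, exists s : 'I_m -> S,
    g = P g + t * h + \sum_j s j * f j.
  move=> g; have [h gh] := hN _ (lP g).
  have /proj_eq/mem_I[s sE] := gh; exists h, s.
  by rewrite -sE; ring.
move=> r; have [g ->] := proj_surj r.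
pose F i := iter i nxt g.
have lt i : low i (t ^+ i) by apply: low1X; apply: low_psX.
pose G (al : 'X_{1..n < N}) i := psC n (pscoef (F i) al) * t ^+ i.
exists (fun al : 'X_{1..n < N} => proj (psum (G al))).
have lG al i : low i (G al i) by apply: lowMl.
split=> [al|].
  exists (psum (G al)) => //.
  by apply: pser_psum => i; apply: pserM; [apply: pserC|apply: pserX].
have lSF j i : low i (t ^+ i * s (F i) j) by apply: lowMr.
suff -> : g = psum (fun i => t ^+ i * P (F i)
    + \sum_j f j * (t ^+ i * s (F i) j)).
  rewrite -psumD; last 2 first.
  - by move=> i; apply: lowMr.
  - by move=> i; apply: low_sum => j _; apply: lowMl.
  rewrite -psum_sum projD [X in _ + X](_ : _ = 0) ?addr0; last first.
    apply/proj_eq0/mem_I; exists (fun j => psum (fun i => t ^+ i * s (F i) j)).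
    by apply: eq_bigr => j _; rewrite [RHS]mulrC psumM.
  under eq_bigr => al _ do rewrite -projM mulrC psumM //.
  rewrite -proj_sum psum_sum; congr (proj (psum _)).
  apply: funext => i; rewrite mulr_sumr.
  by apply: eq_bigr => al _; rewrite /G; ring.
apply: psum_unique.
  move=> i; apply: lowD; first exact: lowMr.
  by apply: low_sum => j _; apply: lowMl.
move=> d; suff -> : g = \sum_(i < d) (t ^+ i * P (F i)
    + \sum_j f j * (t ^+ i * s (F i) j)) + t ^+ d * F d.
  by rewrite addrC addrA addNr add0r; apply: lowMr.
elim: d => [|d IH]; first by rewrite big_ord0 add0r mul1r.
rewrite big_ord_recr /= {1}IH -addrA; congr (_ + _).
rewrite {1}(hs (F d)) !mulrDr exprSr -!mulrA -!addrA; congr (_ + _).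
rewrite addrC; congr (_ + _); rewrite mulr_sumr.
by apply: eq_bigr => j _; rewrite mulrA mulrC.
Qed.

Lemma one_var_rank : exists M, forall q (b : 'I_q -> R),
  independent one_var b -> (q <= M)%N.
Proof.
have [N hN] := finite_over_one_var; exists #|{: 'X_{1..n < N}}| => q b bI.
rewrite leqNgt; apply/negP => qM.
have /choice[a aE] := fun i => hN (b i).
have [|||//|c [Ac [i ci] cE]] := dependent dom one_var1 _ _
  (v := fun (i : 'I_q) al => a i al).
- exact: one_varB.
- exact: one_varM.
- by move=> i al; case: (aE i).
- by rewrite card_ord.
case/eqP: ci; apply: bI => //.
under eq_bigr => j _.
  have [_ ->] := aE j; rewrite mulr_sumr.
  under eq_bigr => al _ do rewrite mulrA.
  over.
by rewrite exchange_big big1 //= => al _; rewrite -mulr_suml cE mul0r.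
Qed.

End Fix.

(** The derivation of [R] that takes the values [v] on the variables; it does not
    depend on the representative as soon as [v] kills the generators of [I]. *)
Definition der_of (v : 'I_n -> R) (r : R) : R :=
  \sum_i v i * proj (psderiv i (repr r)).

Definition kills_I (v : 'I_n -> R) :=
  forall l, \sum_i v i * proj (psderiv i (f l)) = 0.

Lemma der_ofE v g : kills_I v ->
  der_of v (proj g) = \sum_i v i * proj (psderiv i g).
Proof.
move=> vI; have : repr (proj g) - g \in I.
  by apply/proj_eq; rewrite /proj reprK.
move=> /mem_I[c cE]; rewrite /der_of.
have -> : repr (proj g) = g + \sum_j c j * f j by rewrite -cE addrC subrK.
under eq_bigr => i _ do rewrite psderivD projD mulrDr.
rewrite big_split /= [X in _ + X](_ : _ = 0) ?addr0 //.
under eq_bigr => i _.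
  rewrite (big_morph _ (psderivD i) (psderiv0 k i)) proj_sum mulr_sumr.
  over.
rewrite exchange_big big1 //= => j _.
have fj : proj (f j) = 0.
  by apply/proj_eq0; rewrite hf; apply: span_mem; exists j.
under eq_bigr => i _ do rewrite psderivM projD !projM fj mulr0 add0r mulrCA.
by rewrite -mulr_sumr vI mulr0.
Qed.

Lemma der_of_derivation v : kills_I v -> derivation (der_of v).
Proof.
move=> vI; split=> x y; have [g ->] := proj_surj x; have [h ->] := proj_surj y.
  rewrite -projD !der_ofE // -big_split /=; apply: eq_bigr => i _.
  by rewrite psderivD projD mulrDr.
rewrite -projM !der_ofE // !mulr_sumr -big_split /=; apply: eq_bigr => i _.
by rewrite psderivM projD !projM; ring.
Qed.

Lemma der_of_psX v i : kills_I v -> der_of v (proj (psX k i)) = v i.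
Proof.
move=> vI; rewrite der_ofE // (bigD1 i) //= psderivX eqxx proj1 mulr1.
by rewrite big1 ?addr0 // => j /negbTE ji; rewrite psderivX ji proj0 mulr0.
Qed.

Lemma proj_nat_neq0 (i : nat) : i%:R != 0 :> k -> i%:R != 0 :> R.
Proof.
apply: contra => /eqP i0; have : proj (i%:R) = 0 by rewrite rmorph_nat.
by move=> /proj_eq0/(I_const0 Ilow); rewrite pscoefMn pscoef1 eqxx => ->.
Qed.

(** The combination of the two derivations that is zero at [X_i] is zero
    everywhere: in characteristic zero because [R] is algebraic over the
    power series in [X_i]; in characteristic [p] because an element that is not
    a constant of all derivations generates the fraction field over its
    [p]-th powers. *)
Lemma derivations_proportional v w : kills_I v -> kills_I w ->
  forall i j, v i * w j = w i * v j.
Proof.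
move=> vI wI i j.
pose u l := v i * w l - w i * v l.
have uI : kills_I u.
  move=> l; rewrite /u; under eq_bigr => h _ do rewrite mulrBl -!mulrA.
  by rewrite sumrB -!mulr_sumr vI wI !mulr0 subrr.
suff : u j = 0 by move=> /eqP; rewrite subr_eq0 => /eqP.
have ui : u i = 0 by rewrite /u mulrC subrr.
rewrite -(der_of_psX _ uI).
have [[p chark]|nchar] := pselect (exists p, p \in [pchar k]); last first.
  have [M rankM] := one_var_rank i.
  pose x := proj (psX k j).
  have /contrapT : ~ ~ exists c : 'I_M.+1 -> R, [/\ forall l, one_var i (c l),
      exists l, c l != 0 & \sum_l c l * x ^+ l = 0].
    move=> nc; have /rankM : independent (one_var i) (fun l : 'I_M.+1 => x ^+ l).
      move=> c Ac c0 l; apply/eqP/negP => /negP cl.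
      by apply: nc; exists c; split=> //; exists l.
    by rewrite ltnn.
  move=> [c [Ac [l cl] cx]].
  pose q := \poly_(l < M.+1) c (inord l).
  apply: (@der_algebraic _ dom _ (der_of_derivation uI) (one_var i) _ _ M.+1 q).
  - move=> _ [g pg ->]; rewrite der_ofE // big1 // => h _.
    have [->|hi] := eqVneq h i; first by rewrite ui mul0r.
    by rewrite (pser_psderiv hi pg) proj0 mulr0.
  - move=> r h Ar; elim: h => [|h IH].
      by rewrite mulr0n -(subrr r); apply: one_varB.
    have -> : r *+ h.+1 = r *+ h - (r - r - r).
      by rewrite mulrSr subrr sub0r opprK.
    by do !apply: one_varB.
  - move=> h /andP[h0 _]; apply: proj_nat_neq0.
    have /pcharf0P-> : [pchar k] =i pred0; last by rewrite -lt0n.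
    by move=> p; apply/negP => hp; apply: nchar; exists p.
  - move=> h; rewrite coef_poly; case: ifP => _; first exact: Ac.
    by rewrite -(subrr 1); apply: one_varB; apply: one_var1.
  - exact: size_poly.
  - apply: contraNneq cl => q0; have := congr1 (fun q : {poly R} => q`_l) q0.
    by rewrite coef_poly ltn_ord inord_val coef0 => ->.
  - rewrite horner_poly -[RHS]cx; apply: eq_bigr => h _.
    by rewrite inord_val.
have p_pr := pcharf_prime chark.
have charRp : p \in [pchar R].
  apply/andP; split=> //; apply/eqP; rewrite -(rmorph_nat proj).
  rewrite (pcharf0 (pchar_ps n chark)); exact: proj0.
have [M rankM] := one_var_rank i.
pose x := proj (psX k i).
pose B (r : R) := exists s, r = s ^+ p.
have [//|vwi] := pselect (v i = 0 /\ w i = 0).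
  by move=> [v0 w0]; rewrite der_of_psX // /u v0 w0 !mul0r subrr.
have x_degree (q : {poly R}) : (forall l, B q`_l) -> (size q <= p)%N ->
    q.[x] = 0 -> q = 0.
  move=> Bq sq qx; apply/eqP/negP => /negP q0; apply: vwi.
  suff kill z : kills_I z -> z i = 0 by split; apply: kill.
  move=> zI; rewrite -(der_of_psX i zI).
  apply: (@der_algebraic _ dom _ (der_of_derivation zI) B _ _ p q _ _ Bq sq q0 qx).
  - move=> _ [s ->]; rewrite (derX (der_of_derivation zI)).
    by rewrite (pcharf0 charRp) !mul0r.
  - move=> r h [s ->]; elim: h => [|h [s' IH]].
      by exists 0; rewrite mulr0n expr0n (gtn_eqF (prime_gt0 p_pr)).
    by exists (s + s'); rewrite mulrS IH; symmetry; exact: (rmorphD (pFrobenius_aut charRp)).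
  - move=> h /andP[h0 hp]; apply: proj_nat_neq0.
    by rewrite -(dvdn_pcharf chark) gtnNdvd.
have [|||c [[l cl] cE]] := dependent_pth_powers dom charRp (t := x)
  (one_var1 i) _ _ _ rankM
  (fun l : 'I_p.+1 => insert_at ord_max (proj (psX k j)) (fun l : 'I_p => x ^+ l) l).
- exact: one_varB.
- exact: one_varM.
- move=> _ [g pg ->]; have [c [pc ->]] := pser_split chark pg.
  have /choice[d dE] : forall l, exists d, pser i 1 d /\ c l = d ^+ p.
    by move=> l; have [d pd ->] := pser_pth_power chark hk (pc l); exists d.
  exists (fun l => proj (d l)); split=> [l|]; first by exists (d l) => //; case: (dE l).
  rewrite proj_sum; apply: eq_bigr => l _.
  by rewrite projM projX; case: (dE l) => _ ->; rewrite projX.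
move: cE; under eq_bigr => h _ do rewrite mulrC.
rewrite sum_insert_at => cE.
have liftE (h : 'I_p) : lift ord_max h = inord h.
  by apply: ord_inj; rewrite lift_max inordK // ltnS ltnW.
have cmax : c ord_max != 0.
  apply: contraNneq cl => c0.
  pose q := \poly_(h < p) (c (inord h) ^+ p).
  have q0 : q = 0.
    apply: x_degree; last 2 first.
    + exact: size_poly.
    + rewrite horner_poly -[RHS]cE c0 expr0n (gtn_eqF (prime_gt0 p_pr)) mulr0 add0r.
      by apply: eq_bigr => h _; rewrite liftE mulrC.
    move=> h; rewrite coef_poly; case: ifP => _; first by exists (c (inord h)).
    by exists 0; rewrite expr0n (gtn_eqF (prime_gt0 p_pr)).
  have [h ->|->] := unliftP ord_max l; last by rewrite c0.
  have := congr1 (fun q : {poly R} => q`_h) q0.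
  rewrite coef_poly ltn_ord coef0 -liftE => /eqP ch; apply: contraLR ch.
  exact: dom_expf.
have hD := der_of_derivation uI.
have DX s : der_of u (s ^+ p) = 0.
  by rewrite (derX hD) (pcharf0 charRp) !mul0r.
have Dx : der_of u x = 0 by rewrite der_of_psX.
have /dom[/eqP|//] : c ord_max ^+ p * der_of u (proj (psX k j)) = 0; last first.
  by rewrite (negbTE (dom_expf dom _ cmax)).
rewrite -[RHS](der0 hD) -cE (derD hD) (derM hD) DX mulr0 add0r.
rewrite (big_morph _ (derD hD) (der0 hD)) big1 ?addr0 // => h _.
by rewrite (derM hD) DX (derX hD) Dx !mulr0 addr0.
Qed.

End Rank.

(** * Lengths *)

Section Length.
Variables (R : nzRingType) (M : lmodType R).

Lemma submod_chainW l l' : (l' <= l)%N -> submod_chain M l -> submod_chain M l'.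
Proof. by move=> l'l [N hN]; exists N => i il; apply: hN; apply: leq_trans l'l. Qed.

Lemma le_module_length l : submod_chain M l ->
  (EFin (l%:R : rat) <= module_length M)%O.
Proof.
move=> hl; apply: ge_supremum_Nmem; last by exists l.
pose A := [set EFin (l%:R : rat) | l in submod_chain M].
have [[B hB]|unb] := pselect (exists B, forall l, submod_chain M l -> (l <= B)%N).
  pose P q := `[< submod_chain M q >].
  have [e /asboolP he emax] := @ex_maxnP P B (ex_intro _ l (asboolT hl))
    (fun q hq => hB q (asboolW hq)).
  exists (EFin e%:R); split; last by move=> b; apply; exists e.
  by move=> _ [q hq <-]; rewrite lee_fin ler_nat; apply/emax/asboolP.
exists (EPInf rat); split=> [_ [q _ <-]|b bub]; first exact: leey.
case: b bub => [q|//|] bub; last first.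
  by have := bub _ (ex_intro2 _ _ l hl erefl); rewrite leeNy_eq => /eqP.
exfalso; apply: unb; exists (Num.bound q) => l' hl'.
have := bub _ (ex_intro2 _ _ l' hl' erefl); rewrite lee_fin => l'q.
rewrite -(ler_nat rat); apply: le_trans l'q _; apply: ltW; apply: archi_boundP.
have := bub _ (ex_intro2 _ _ l hl erefl); rewrite lee_fin; apply: le_trans.
exact: ler0n.
Qed.

(** Lower bounds for a length come from filtrations some of whose steps may
    collapse; the collapsed steps are dropped. *)
Lemma submod_chain_count (P : nat -> submodClosed M) N :
  (forall i, (i < N)%N -> {subset P i <= P i.+1}) ->
  submod_chain M (\sum_(i < N) ~~ `[< {subset P i.+1 <= P i} >])%N.
Proof.
move=> PS; suff [Q [QS _]] : exists Q : nat -> submodClosed M,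
    (forall i, (i < \sum_(i < N) ~~ `[< {subset P i.+1 <= P i} >])%N ->
      {subset Q i <= Q i.+1} /\ ~ {subset Q i.+1 <= Q i}) /\
    {subset Q (\sum_(i < N) ~~ `[< {subset P i.+1 <= P i} >])%N <= P N}.
  by exists Q.
elim: N PS => [|N IH] PS; first by exists P; rewrite big_ord0; split.
have [i iN|Q [QS QP]] := IH; first exact: PS (ltnW iN).
rewrite big_ord_recr /=; set c := \sum_(i < N) _ in QS QP *.
have PN : {subset P N <= P N.+1} by apply: PS.
case: asboolP => [_|PNs] /=.
  by rewrite addn0; exists Q; split=> // x /QP/PN.
exists (fun i => if (i <= c)%N then Q i else P N.+1); rewrite addn1 ltnn.
split=> // i; rewrite ltnS leq_eqVlt => /predU1P[->|ic].
  rewrite eqxx ltnn /=; split=> [x /QP/PN//|h].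
  by apply: PNs => x /h/QP.
by rewrite ic orbT; apply: QS.
Qed.

End Length.

Lemma card_bmultinom n s : #|{: 'X_{1..n < s.+1}}| = 'C(n + s, s).
Proof.
have -> : 'C(n + s, s) = 'C(n + s, n) by rewrite -bin_sub ?leq_addl // addnK.
rewrite -card_partial_ord_partitions.
pose F (a : 'X_{1..n < s.+1}) : n.-tuple 'I_s.+1 :=
  [tuple inord (bmnm a i) | i < n].
have aS (a : 'X_{1..n < s.+1}) i : (bmnm a i < s.+1)%N.
  apply: leq_ltn_trans (bmdeg a); rewrite mdegE (bigD1 i) //=; exact: leq_addr.
have Finj : injective F.
  move=> a b ab; apply/val_inj/mnmP => i.
  have := congr1 (fun t : n.-tuple 'I_s.+1 => nat_of_ord (tnth t i)) ab.
  by rewrite !tnth_mktuple !inordK // ?aS.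
rewrite -(card_imset _ Finj) /=; apply: eq_card => u; rewrite inE.
apply/imsetP/idP => [[a _ ->]|us].
  rewrite -ltnS; apply: leq_ltn_trans (bmdeg a); rewrite mdegE big_tuple.
  by apply: leq_sum => i _; rewrite tnth_mktuple inordK ?aS.
have ud : (mdeg [multinom tnth u i : nat | i < n] < s.+1)%N.
  rewrite ltnS mdegE; apply: leq_trans us; rewrite big_tuple.
  by apply: leq_sum => i _; rewrite mnmE.
exists (BMultinom ud) => //; apply: eq_from_tnth => i.
by apply: ord_inj; rewrite tnth_mktuple /= mnmE inordK.
Qed.

Section Colength.
Variables (n : nat) (k : fieldType) (I : idealr (pseries n k)).
Local Notation S := (pseries n k).
Local Notation R := {ideal_quot I}.
Variable s : nat.
Local Notation T := ('X_{1..n < s.+1}).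

(** A numbering of the monomials of degree at most [s] that grows under
    multiplication, so that the series without monomials of rank below [j] form
    an ideal. All monomials of larger degree get the same, maximal, rank. *)
Definition mrank (m : 'X_{1..n}) : nat := #|[set b : T | (bmnm b < m)%O]%SET|.

Lemma mrank_le m m' : (m <= m')%O -> (mrank m <= mrank m')%N.
Proof.
move=> mm; apply: subset_leq_card; apply/fintype.subsetP => b; rewrite !inE => bm.
exact: lt_le_trans mm.
Qed.

Lemma mrank_lt (m : T) (m' : 'X_{1..n}) : (bmnm m < m')%O -> (mrank m < mrank m')%N.
Proof.
move=> mm; apply: proper_card; apply/fintype.properP; split.
  by apply/fintype.subsetP => b; rewrite !inE => bm; apply: lt_trans mm.
by exists m; rewrite !inE ?ltxx.
Qed.

Lemma mrank_ltn (m : T) : (mrank m < #|{: T}|)%N.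
Proof.
rewrite -cardsT; apply: proper_card; apply/fintype.properP; split; first exact: finset.subsetT.
by exists m => //; rewrite inE ltxx.
Qed.

Lemma mrank_inj (m m' : T) : mrank m = mrank m' -> m = m'.
Proof.
move=> mm; apply/val_inj; case: (ltgtP (bmnm m) (bmnm m')) => //.
  by move/mrank_lt; rewrite mm ltnn.
by move/mrank_lt; rewrite mm ltnn.
Qed.

Lemma mrank_bij : bijective (fun m : T => Ordinal (mrank_ltn m)).
Proof.
apply: inj_card_bij; last by rewrite card_ord.
by move=> m m' [/mrank_inj].
Qed.

Definition lowr j (f : S) := forall m, (mrank m < j)%N -> pscoef f m = 0.

Lemma lowrM j f g : lowr j g -> lowr j (f * g).
Proof.
move=> lg m mj; rewrite pscoefM big1 // => -[[a ha] [b hb]] /= /eqP mE.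
rewrite lg ?mulr0 //; apply: leq_ltn_trans mj; apply: mrank_le.
by rewrite mE; apply: lemc_addl.
Qed.

Variables (M : lmodType R) (theta : S -> M).
Hypothesis thetaB : forall f g, theta (f - g) = theta f - theta g.
Hypothesis thetaM : forall f g, theta (f * g) = proj I f *: theta g.

Lemma theta0 : theta 0 = 0.
Proof. by rewrite -(subrr 0) thetaB subrr. Qed.

Definition lowr_submod (j : nat) : submod_prop M.
Proof.
refine (@SubmodProp R M (fun x => exists2 f, lowr j f & x = theta f) _ _ _).
- by exists 0; rewrite ?theta0.
- move=> _ _ [f lf ->] [g lg ->]; exists (f - (0 - g)).
    by move=> m mj; rewrite !pscoefB lf ?lg // !subr0.
  by rewrite !thetaB theta0 sub0r opprK.
- move=> r _ [f lf ->]; have [g ->] := proj_surj r.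
  by exists (g * f); [apply: lowrM|rewrite thetaM].
Defined.

(** The submodules generated by the monomials of rank at least [j] form a
    sequence with one step for each monomial of degree at most [s]. A step is
    not strict only if its monomial is the lowest one of a series in the kernel
    of [theta]. Series in the kernel with distinct lowest monomials are linearly
    independent modulo terms of degree greater than [s], so there are at most
    [r] of them. *)
Lemma submod_chain_colength r (w : 'I_r -> S) :
    (forall g, theta g = 0 -> exists c : 'I_r -> k,
      low s.+1 (g - \sum_i psC n (c i) * w i)) ->
  submod_chain M ('C(n + s, s) - r).
Proof.
move=> hw; rewrite -card_bmultinom; set N := #|_|.
pose P j := submod_of (lowr_submod (N - j)).
have PP i x : reflect (exists2 f, lowr (N - i) f & x = theta f) (x \in P i).
  by rewrite submod_ofE; exact: (@asboolP (lowr_submod (N - i) x)).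
have PS i : (i < N)%N -> {subset P i <= P i.+1}.
  move=> iN x /PP[f lf ->]; apply/PP; exists f => // m mi; apply: lf.
  by apply: leq_trans mi _; apply: leq_sub2l.
apply: submod_chainW (submod_chain_count PS).
pose J := [set i : 'I_N | `[< {subset P i.+1 <= P i} >]]%SET.
have -> : (\sum_(i < N) ~~ `[< {subset P i.+1 <= P i} >] = N - #|J|)%N.
  have -> : (N - #|J| = #|~: J|%SET)%N by rewrite (cardsCs (~: J)%SET) finset.setCK card_ord.
  rewrite -sum1_card [RHS]big_mkcond /=.
  by apply: eq_bigr => i _; rewrite !inE; case: asboolP.
apply: leq_sub2l; rewrite leqNgt; apply/negP => rJ.
have [inv invK Kinv] := mrank_bij.
have mono (j : 'I_N) : mrank (inv j) = j by have := congr1 val (Kinv j).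
have lead (j : 'I_#|J|) : exists g (e : 'I_N), [/\ e = rev_ord (enum_val j),
    theta g = 0, lowr e g & pscoef g (inv e) = 1].
  set i := enum_val j; pose e := rev_ord i.
  have iJ : {subset P i.+1 <= P i}.
    by have := enum_valP j; rewrite inE => /asboolP.
  have ei : (N - i)%N = e.+1 by rewrite /= subnSK.
  have /iJ/PP[g'] : theta (psXm k (inv e)) \in P i.+1.
    apply/PP; exists (psXm k (inv e)) => // m; rewrite pscoef_psXm.
    have [->|//] := eqVneq m (inv e).
    by rewrite mono /= ltnn.
  rewrite ei => lg' tg'; exists (psXm k (inv e) - g'), e; split=> //.
  - by rewrite thetaB tg' subrr.
  - move=> m me; rewrite pscoefB lg' ?subr0; last exact: ltnW.
    rewrite pscoef_psXm; have [mE|//] := eqVneq m (inv e).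
    by move: me; rewrite mE mono ltnn.
  - by rewrite pscoefB pscoef_psXm eqxx lg' ?subr0 // mono.
have /choice[g /choice[e ge]] := lead.
have /choice[C hC] : forall j, exists c : 'I_r -> k,
    low s.+1 (g j - \sum_i psC n (c i) * w i).
  by move=> j; apply: hw; case: (ge j).
have fdom (x y : k) : x * y = 0 -> x = 0 \/ y = 0.
  by move=> /eqP; rewrite mulf_eq0 => /orP[]/eqP; [left|right].
have [||||c [_ [j0 cj0] cC]] := @dependent _ fdom (fun=> True) Logic.I _ _ _ _ C.
- by [].
- by [].
- by [].
- by rewrite !card_ord.
have [j cj jmin] := @arg_minnP _ j0 (fun j => c j != 0) (fun j => e j : nat) cj0.
pose G := \sum_i psC n (c i) * g i.
have lG : low s.+1 G.
  have -> : G = \sum_i psC n (c i) * (g i - \sum_l psC n (C i l) * w l).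
    rewrite /G; under [RHS]eq_bigr => i _ do rewrite mulrBr mulr_sumr.
    rewrite sumrB [X in _ - X](_ : _ = 0) ?subr0 //.
    rewrite exchange_big big1 //= => l _.
    under eq_bigr => i _ do rewrite mulrA -psCM.
    by rewrite -mulr_suml -(big_morph _ (psCD n (k := k)) (psC0 n k)) cC psC0 mul0r.
  by apply: low_sum => i _; apply: lowMl.
have := lG (inv (e j)) (bmdeg _).
rewrite /G pscoef_sum; under eq_bigr => i _ do rewrite pscoef_CM.
rewrite (bigD1 j) //=; case: (ge j) => ejE _ _ ->; rewrite mulr1 big1 ?addr0.
  by move=> c0; rewrite c0 eqxx in cj.
move=> i ij; have [->|ci] := eqVneq (c i) 0; first by rewrite mul0r.
case: (ge i) => eiE _ li _; rewrite li ?mulr0 // mono.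
rewrite ltn_neqAle jmin // andbT; apply: contra ij => /eqP eij.
apply/eqP/esym/enum_val_inj/rev_ord_inj.
by apply: ord_inj; rewrite -eiE -ejE.
Qed.

End Colength.

(** * Syzygies of the image of a linear form *)

Section SumAlternating.
Variables (V : zmodType) (n : nat).

Lemma sum_alternating (t : 'I_n -> 'I_n -> V) :
  (forall i, t i i = 0) -> (forall i j, t i j + t j i = 0) ->
  \sum_i \sum_j t i j = 0.
Proof.
move=> tii tij.
have E : \sum_i \sum_j t i j = \sum_(i < n) \sum_(j < n) (if (i < j)%N then t i j else 0)
    + \sum_(i < n) \sum_(j < n) (if (j < i)%N then t i j else 0).
  rewrite -big_split; apply: eq_bigr => i _; rewrite -big_split.
  apply: eq_bigr => j _ /=; case: ltngtP => [_|_|/ord_inj->].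
  - by rewrite addr0.
  - by rewrite add0r.
  - by rewrite tii addr0.
rewrite E [X in _ + X]exchange_big -big_split big1 //= => i _.
rewrite -big_split big1 //= => j _.
by case: ifP => _; rewrite ?tij ?addr0.
Qed.

End SumAlternating.

Lemma sum_delta (R : nzRingType) n (l : 'I_n) (h : 'I_n -> R) :
  \sum_q (q == l)%:R * h q = h l.
Proof.
by rewrite (bigD1 l) //= eqxx mul1r big1 ?addr0 // => q /negbTE->; rewrite mul0r.
Qed.

Definition koszul (R : comNzRingType) n (u : 'I_n -> R) (i j q : 'I_n) : R :=
  (q == j)%:R * u i - (q == i)%:R * u j.

Lemma koszul_syzygy (R : comNzRingType) n (u : 'I_n -> R) i j :
  \sum_q koszul u i j q * u q = 0.
Proof.
under eq_bigr => q _ do rewrite /koszul mulrBl -!mulrA.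
by rewrite sumrB !sum_delta mulrC subrr.
Qed.

Section Syzygies.
Variables (n : nat) (k : fieldType) (I : idealr (pseries n k)).
Local Notation S := (pseries n k).
Local Notation R := {ideal_quot I}.
Local Notation proj := (proj I).
Variables (m : nat) (f : 'I_m -> S).
Hypothesis hf : I =i ideal_gen (range f).
Hypothesis dom : forall x y : R, x * y = 0 -> x = 0 \/ y = 0.
Hypothesis hdim : forall l, prime_chain R l -> (l <= 1)%N.
Hypothesis hk : perfect_field k.
Variable s : nat.
Hypothesis s_gt0 : (0 < s)%N.
Hypothesis Ilows : forall f, f \in I -> low s.+1 f.
Variables i0 i1 : 'I_n.
Hypothesis i01 : i0 != i1.

Let Ilow g (gI : g \in I) : low 2 g.
Proof. by apply: lowW (Ilows gI). Qed.

Let fI j : f j \in I.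
Proof. by rewrite hf; apply: span_mem; exists j. Qed.

Definition omega (a : 'I_n -> R) : Omega I f := (\pi_(Omega I f) (\row_i a i))%qT.

Lemma omegaZ r a : omega (fun i => r * a i) = r *: omega a.
Proof.
rewrite [RHS]lmquot_scaleE; congr (\pi_(Omega I f) _)%qT.
by apply/rowP => i; rewrite !mxE.
Qed.

Lemma omega_surj x : exists a, x = omega a.
Proof.
elim/quotW: x => a; exists (fun i => a 0 i); congr (\pi_(Omega I f) _)%qT.
by apply/rowP => i; rewrite mxE.
Qed.

Lemma omega0 : omega (fun=> 0) = 0.
Proof.
have h := omegaZ 0 (fun=> 0); rewrite scale0r in h; rewrite -h.
by congr omega; apply: funext => i; rewrite mul0r.
Qed.

Lemma omega_eq0 a : omega a = 0 <->
  exists c : 'I_m -> R, forall i, a i = \sum_j c j * proj (psderiv i (f j)).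
Proof.
rewrite -omega0; have E := @lmquot_eqP R _ (Defs.span (range (ps_diff I \o f)))
  (\row_i a i) (\row_i 0).
transitivity (\row_i a i - \row_i 0 \in Defs.span (range (ps_diff I \o f))).
  exact: (rwP E).
rewrite span_rangeP; split=> -[c cE]; exists c.
  move=> i; have /rowP/(_ i) := cE; rewrite !mxE subr0 => ->; rewrite summxE.
  by apply: eq_bigr => j _; rewrite !mxE.
apply/rowP => i; rewrite !mxE subr0 cE summxE.
by apply: eq_bigr => j _; rewrite !mxE.
Qed.

Variable phi : {linear Omega I f -> R^o}.

Definition phi_dX (i : 'I_n) : R := phi (\pi_(Omega I f) (delta_mx 0 i))%qT.
Local Notation u := phi_dX.

Lemma phi_omega a : phi (omega a) = \sum_i a i * u i :> R.
Proof.
rewrite /omega [\row_i a i]row_sum_delta.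
have pi0 : (\pi_(Omega I f) 0)%qT = 0.
  by apply: (addrI (\pi_(Omega I f) 0)%qT); rewrite -lmquot_piD !addr0.
rewrite (big_morph _ (@lmquot_piD _ _ _) pi0) linear_sum /=.
apply: eq_bigr => i _; rewrite mxE.
transitivity (phi (a i *: \pi_(Omega I f) (delta_mx 0 i))%qT).
  by rewrite [X in _ = phi X]lmquot_scaleE.
by rewrite linearZ.
Qed.

Lemma phi_kills_I : kills_I f u.
Proof.
move=> l; have /omega_eq0 w0 : exists c : 'I_m -> R,
    forall i, proj (psderiv i (f l)) = \sum_j c j * proj (psderiv i (f j)).
  by exists (fun j => (j == l)%:R) => i; rewrite sum_delta.
under eq_bigr => i _ do rewrite mulrC.
by rewrite -phi_omega w0 linear0.
Qed.

Hypothesis torsion0 : torsion (Omega I f) = [set 0].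

(** As two derivations are proportional, the Jacobian matrix has corank one:
    a linear form that vanishes on the rows of the Jacobian matrix is
    proportional to [u]. A syzygy of [u] is therefore a combination of these
    rows up to a factor, that is, a torsion element. *)
Lemma syzygy_span (a : 'I_n -> R) : (exists i, u i != 0) ->
    \sum_i a i * u i = 0 ->
  exists c : 'I_m -> R, forall i, a i = \sum_j c j * proj (psderiv i (f j)).
Proof.
move=> [i ui] au; apply/omega_eq0.
have [[r [c [r0 rc]]]|[v [vI va]]] :=
  span_or_form dom (fun j i => proj (psderiv i (f j))) a.
  suff : torsion (Omega I f) (omega a) by rewrite torsion0.
  exists r; split.
    move=> x y /eqP; rewrite -subr_eq0 -mulrBr => /eqP/dom[/eqP|/eqP].
      by rewrite (negbTE r0).
    by rewrite subr_eq0 => /eqP.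
  rewrite -omegaZ; apply/omega_eq0; exists c => l; exact: rc.
have vI' : kills_I f v.
  by move=> l; rewrite -[RHS](vI l); apply: eq_bigr => j _; rewrite mulrC.
suff /dom[/eqP|/eqP] : u i * \sum_j a j * v j = 0.
- by rewrite (negbTE ui).
- by rewrite (negbTE va).
rewrite mulr_sumr; under eq_bigr => j _.
  rewrite mulrCA -(derivations_proportional hf Ilow dom hdim hk vI' phi_kills_I).
  rewrite mulrCA.
  over.
by rewrite -mulr_sumr au mulr0.
Qed.

Variable U : 'I_n -> S.
Hypothesis hU : forall i, proj (U i) = u i.

(** The coefficients of a combination of the gradients of the [f j] may be replaced
    by their constant terms, because the gradients have order at least [s]; the
    result is the gradient of one element of [I]. *)
Lemma syzygy_gradient (g : 'I_n -> S) : (exists i, u i != 0) ->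
    proj (\sum_i g i * U i) = 0 ->
  exists2 F, F \in I & forall i, low s.+1 (g i - psderiv i F).
Proof.
move=> u0 gu; have [|c cE] := @syzygy_span (fun i => proj (g i)) u0.
  by rewrite -[RHS]gu proj_sum; apply: eq_bigr => i _; rewrite projM hU.
have /choice[C CE] j := proj_surj (c j).
exists (\sum_j psC n (pscoef (C j) 0%MM) * f j).
  by apply/(mem_I hf); exists (fun j => psC n (pscoef (C j) 0%MM)).
move=> i; rewrite (big_morph _ (psderivD i) (psderiv0 k i)).
have -> : \sum_j psderiv i (psC n (pscoef (C j) 0%MM) * f j) =
    \sum_j psC n (pscoef (C j) 0%MM) * psderiv i (f j).
  apply: eq_bigr => j _; apply/pseriesP => a.
  rewrite [RHS]pscoef_CM.
  rewrite -[LHS]/(pscoef (psC n (pscoef (C j) 0%MM) * f j) (a + U_(i))%MM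
                  *+ (a i).+1).
  by rewrite pscoef_CM mulrnAr.
rewrite -[g i](subrK (\sum_j C j * psderiv i (f j))) -addrA; apply: lowD.
  apply: Ilows; apply/proj_eq0; rewrite projB cE proj_sum; apply/eqP.
  by rewrite subr_eq0; apply/eqP/eq_bigr => j _; rewrite projM CE.
rewrite -sumrB; apply: low_sum => j _; rewrite -mulrBl -[s.+1]add1n.
apply: lowM; first exact: psC_low.
by apply: low_psderiv; apply: Ilows.
Qed.

(** Modulo terms of degree greater than [s], the Koszul syzygy between [U i] and
    [U j] is the gradient of an element of [I], and the partial derivatives of
    such an element have order at least [s]. *)
Lemma low_U i : (exists i, u i != 0) -> low s (U i).
Proof.
move=> u0.
have [j ij] : exists j, j != i.
  by have [<-|?] := eqVneq i0 i; [exists i1; rewrite eq_sym|exists i0].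
have [|F FI hF] := @syzygy_gradient (koszul U i j) u0.
  by rewrite koszul_syzygy proj0.
have := hF j; rewrite /koszul eqxx mul1r (negbTE ij) mul0r subr0 => h.
rewrite -[U i](subrK (psderiv j F)); apply: lowD; first exact: lowW h.
by apply: low_psderiv; apply: Ilows.
Qed.

(** The composite of the projections from the power series ring to [R] and to the
    quotient of [R] by the image of [phi]. *)
Definition to_colength (g : S) : lmquot (lin_image phi) :=
  (\pi_(lmquot (lin_image phi)) (proj g : R^o))%qT.

Lemma to_colengthB g h : to_colength (g - h) = to_colength g - to_colength h.
Proof.
have D x y : to_colength (x + y) = to_colength x + to_colength y.
  by rewrite /to_colength projD lmquot_piD.
by apply/eqP; rewrite eq_sym subr_eq -D subrK.
Qed.

Lemma to_colengthM g h : to_colength (g * h) = proj g *: to_colength h.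
Proof. by rewrite [RHS]lmquot_scaleE /to_colength projM. Qed.

Lemma to_colength_eq0 g : to_colength g = 0 ->
  exists a : 'I_n -> S, g - \sum_i a i * U i \in I.
Proof.
rewrite -(subrr (to_colength 0)) -to_colengthB subrr => /lmquot_eqP.
rewrite proj0 subr0 => /asboolP[x]; have [a ->] := omega_surj x.
rewrite phi_omega => aE; have /choice[A AE] i := proj_surj (a i).
exists A; apply/proj_eq0; rewrite projB -aE proj_sum; apply/eqP.
by rewrite subr_eq0; apply/eqP/eq_bigr => i _; rewrite projM hU AE.
Qed.

(** The coefficients [a i] of an element of the image matter only through their
    constant terms, since the [U i] have order at least [s]. *)
Lemma submod_chain_image r (w : 'I_r -> S) : (forall i, low s (U i)) ->
    (forall i, exists c : 'I_r -> k, low s.+1 (U i - \sum_l psC n (c l) * w l)) ->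
  submod_chain (lmquot (lin_image phi)) ('C(n + s, s) - r).
Proof.
move=> lU /choice[C hC]; apply: (submod_chain_colength to_colengthB to_colengthM (w := w)).
move=> g /to_colength_eq0[a ga].
pose c l := \sum_i pscoef (a i) 0%MM * C i l; exists c.
have -> : \sum_l psC n (c l) * w l =
    \sum_i psC n (pscoef (a i) 0%MM) * \sum_l psC n (C i l) * w l.
  under [RHS]eq_bigr => i _ do rewrite mulr_sumr.
  rewrite [RHS]exchange_big; apply: eq_bigr => l _.
  rewrite (big_morph _ (psCD n (k := k)) (psC0 n k)) mulr_suml.
  by apply: eq_bigr => i _; rewrite psCM mulrA.
rewrite -[g](subrK (\sum_i a i * U i)) -addrA; apply: lowD; first exact: Ilows.
rewrite -sumrB; apply: low_sum => i _.
rewrite -[a i * _](subrK (psC n (pscoef (a i) 0%MM) * U i)) -mulrBl -addrA -mulrBr.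
apply: lowD; last exact: lowMl.
by rewrite -[s.+1]add1n; apply: lowM => //; apply: psC_low.
Qed.

End Syzygies.

(** * Vectors whose syzygies are gradients modulo terms of degree two *)

Section LinearPart.
Variables (n : nat) (k : fieldType) (I : idealr (pseries n k)).
Local Notation S := (pseries n k).
Hypothesis Ilow : forall f, f \in I -> low 2 f.
Variable U : 'I_n -> S.
Hypothesis U_low : forall i, low 1 (U i).
Hypothesis syz : forall g : 'I_n -> S, \sum_i g i * U i \in I ->
  exists2 F, F \in I & forall i, low 2 (g i - psderiv i F).
Variables i0 i1 : 'I_n.
Hypothesis i01 : i0 != i1.

Definition linear_part (g : 'I_n -> S) : 'M[k]_n :=
  \matrix_(q, p) pscoef (g q) U_(p)%MM.

(** The Hessian matrix of the quadratic part of [F]. Its diagonal entries are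
    twice the coefficients of the squares, hence zero in characteristic two. *)
Definition hess (F : S) : 'M[k]_n := linear_part (fun q => psderiv q F).

Lemma hess_sym F : (hess F)^T = hess F.
Proof.
apply/matrixP => q p; rewrite !mxE /= addmC !mnm1E; congr (_ *+ _.+1).
by rewrite eq_sym.
Qed.

Lemma syz_hess g : \sum_i g i * U i \in I ->
  exists2 F, F \in I & linear_part g = hess F.
Proof.
move=> /syz[F FI hF]; exists F => //; apply/matrixP => q p; rewrite !mxE.
by apply/eqP; rewrite -subr_eq0 -pscoefB hF // mdeg1.
Qed.

Definition linU := linear_part U.

Definition alternating (N : 'M[k]_n) := N^T = - N /\ forall i, N i i = 0.

Lemma pscoef_boolM (b : bool) (h : S) a : pscoef (b%:R * h) a = b%:R * pscoef h a.
Proof. by case: b; rewrite ?mul1r ?mul0r. Qed.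

Lemma koszul_entry (i j q p : 'I_n) :
  ((delta_mx j i - delta_mx i j) *m linU) q p = (q == j)%:R * linU i p - (q == i)%:R * linU j p.
Proof.
have Ek (a b : 'I_n) : \sum_l delta_mx a b q l * linU l p = (q == a)%:R * linU b p.
  rewrite -[RHS](sum_delta b (fun l => (q == a)%:R * linU l p)).
  by apply: eq_bigr => l _; rewrite mxE andbC -mulnb natrM mulrA.
by rewrite mulmxBl [LHS]mxE [X in _ + X]mxE ![(_ *m linU) _ _]mxE !Ek.
Qed.

Lemma koszul_hess (i j : 'I_n) : exists2 F, F \in I &
  (delta_mx j i - delta_mx i j) *m linU = hess F.
Proof.
have [|F FI gF] := @syz_hess (koszul U i j); first by rewrite koszul_syzygy rpred0.
exists F => //; rewrite -gF; apply/matrixP => q p.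
by rewrite koszul_entry !mxE /koszul pscoefB !pscoef_boolM.
Qed.

(** By linearity from the syzygies [U_i e_j - U_j e_i], whose linear parts are
    Hessian matrices, hence symmetric. *)
Lemma alternating_A N : alternating N -> linU^T *m N + N *m linU = 0.
Proof.
move=> [NT Nii].
pose t i j := N i j *: (linU^T *m delta_mx i j + delta_mx i j *m linU).
have -> : linU^T *m N + N *m linU = \sum_i \sum_j t i j.
  rewrite {1 2}[N]matrix_sum_delta mulmx_sumr mulmx_suml -big_split /=.
  apply: eq_bigr => i _; rewrite mulmx_sumr mulmx_suml -big_split /=.
  by apply: eq_bigr => j _; rewrite -scalemxAr -scalemxAl -scalerDr.
apply: sum_alternating => [i|i j]; first by rewrite /t Nii scale0r.
have Nji : N j i = - N i j by have /matrixP/(_ i j) := NT; rewrite !mxE.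
rewrite /t Nji scaleNr -scalerBr; apply/eqP; rewrite scaler_eq0; apply/orP; right.
have [F _ hF] := koszul_hess j i; have := hess_sym F; rewrite -hF.
rewrite trmx_mul linearB /= !trmx_delta mulmxBr mulmxBl => h.
by rewrite opprD addrACA -mulmxBl -mulmxBr mulmxBr mulmxBl -opprB h addNr.
Qed.

Definition pconst (f : S) : k := pscoef f 0%MM.
Fact pconst_is_zmod : zmod_morphism pconst. Proof. by []. Qed.
Fact pconst_is_monoid : monoid_morphism pconst.
Proof. by split; [rewrite /pconst pscoef1 eqxx|apply: pscoefM0]. Qed.
HB.instance Definition _ := GRing.isZmodMorphism.Build S k pconst pconst_is_zmod.
HB.instance Definition _ := GRing.isMonoidMorphism.Build S k pconst pconst_is_monoid.

Lemma hess_split F (G : 'I_n -> S) : F = \sum_i psX k i * G i ->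
  (forall i, low 1 (G i)) -> hess F = linear_part G + (linear_part G)^T.
Proof.
move=> -> lG; apply/matrixP => q p; rewrite !mxE.
rewrite (big_morph _ (psderivD q) (psderiv0 k q)) pscoef_sum.
under eq_bigr => i _ do rewrite psderivM pscoefD psderivX pscoef_boolM
  psX_psXm pscoef_psXmM lep1mP mnm1E.
rewrite big_split /=; congr (_ + _).
  rewrite (bigD1 q) //= eqxx mul1r big1 ?addr0 // => i /negbTE.
  by rewrite eq_sym => ->; rewrite mul0r.
rewrite (bigD1 p) //= eqxx /= big1 ?addr0; last first.
  by move=> i ip; rewrite [p == i]eq_sym (negbTE ip).
have -> : (U_(p) - U_(p) = 0 :> 'X_{1..n})%MM.
  by apply/mnmP => i; rewrite mnmBE subnn mnm0E.
by rewrite add0m mnm0E.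
Qed.

(** Writing [F] in [I] as the sum of the [X_i * G_i], Cramer's rule turns a
    multiple of it into a combination of the [U_i]. *)
Lemma cramer_hess F (G : 'I_n -> S) : F \in I -> F = \sum_i psX k i * G i ->
    (forall i, low 1 (G i)) ->
  exists2 F', F' \in I & (\adj linU)^T *m linear_part G = hess F'.
Proof.
move=> FI FG lG.
have /choice[B BE] : forall i, exists B : 'I_n -> S, U i = \sum_j psX k j * B j.
  by move=> i; have [B BE _] := low_split (U_low i); exists B.
pose A' : 'M[S]_n := \matrix_(i, j) B i j.
have UE i : U i = \sum_j A' i j * psX k j.
  by rewrite {1}BE; apply: eq_bigr => j _; rewrite mxE mulrC.
have A'A : map_mx pconst A' = linU.
  apply/matrixP => i l; rewrite !mxE UE pscoef_sum.
  under eq_bigr => j _ do rewrite mulrC psX_psXm pscoef_psXmM lep1mP mnm1E.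
  rewrite (bigD1 l) //= big1 ?addr0; last by move=> j /negbTE jl; rewrite [l == j]eq_sym jl.
  rewrite eqxx mxE /pconst.
  by congr pscoef; apply/mnmP => j; rewrite mnmBE subnn mnm0E.
pose g j := \sum_i G i * \adj A' i j.
have [|F' F'I gF'] := @syz_hess g.
  have -> : \sum_j g j * U j = \det A' * F.
    rewrite FG mulr_sumr; under eq_bigr => j _ do rewrite mulr_suml.
    rewrite exchange_big; apply: eq_bigr => i _ /=.
    have /matrixP/(_ i) h := mul_adj_mx A'.
    transitivity (G i * \sum_l (\sum_j \adj A' i j * A' j l) * psX k l).
      under [X in G i * X]eq_bigr => l _ do rewrite mulr_suml.
      rewrite exchange_big mulr_sumr; apply: eq_bigr => j _ /=.
      rewrite UE -mulrA mulr_sumr; congr (_ * _); apply: eq_bigr => l _.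
      by rewrite mulrA.
    have {}h l : \sum_j \adj A' i j * A' j l = \det A' *+ (i == l).
      by have := h l; rewrite !mxE.
    under eq_bigr => l _ do rewrite h.
    rewrite (bigD1 i) //= eqxx mulr1n big1 ?addr0; first by ring.
    by move=> l; rewrite eq_sym => /negbTE->; rewrite mulr0n mul0r.
  exact: idealMr.
have adjE i j : pscoef (\adj A' i j) 0%MM = \adj linU i j.
  by rewrite -A'A -map_mx_adj [RHS]mxE.
exists F' => //; rewrite -gF'; apply/matrixP => j p.
rewrite [LHS]mxE [RHS]mxE /g pscoef_sum; apply: eq_bigr => i _.
rewrite (pscoefM_low _ (lG i)) ?mdeg1 // adjE [(\adj linU)^T _ _]mxE.
by rewrite [linear_part G _ _]mxE mulrC.
Qed.

(** If a combination of the linear parts with coefficients [c] is zero, the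
    Koszul syzygies show that each is proportional to [c]. If they are linearly
    independent, put [D = adj linU] and [d = det linU], and let [N] be a nonzero
    alternating matrix. Then [N linU] is the Hessian matrix [Q + Q^T] of an
    element of [I], and [D^T Q] is symmetric, being a Hessian matrix. As
    [D^T (Q - Q^T)] is symmetric, so is [D^T N linU = - d N], whence [2 = 0].
    But then the symmetric matrix [D^T Q] is alternating, so that
    [d Q = linU^T D^T Q = - D^T Q linU = - d Q^T] and [N linU = 0]. *)
Lemma linear_part_rank1 : exists l : S, forall i, exists c, low 2 (U i - psC n c * l).
Proof.
have [[c [[q0 cq0] cA]]|nc] := pselect (exists c : 'I_n -> k,
    (exists i, c i != 0) /\ forall p, \sum_i c i * linU i p = 0).
  pose l : S := \sum_p psC n (c p) * psX k p.
  have lE p : pscoef l U_(p)%MM = c p.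
    rewrite pscoef_sum; under eq_bigr => q _ do rewrite pscoef_CM.
    rewrite (bigD1 p) //= eqxx mulr1 big1 ?addr0 // => q qp.
    by rewrite eq_mnm1 eq_sym (negbTE qp) mulr0.
  have ll : low 1 l by apply: low_sum => p _; apply: lowMl; apply: low_psX.
  exists l => j; exists (linU j q0 / c q0) => a ad.
  have [/eqP/mdeg1P[p /eqP->]|a1] := eqVneq (mdeg a) 1%N; last first.
    have a0 : (mdeg a < 1)%N by case: (mdeg a) a1 ad => [|[|]].
    by apply: (lowB (U_low j)) a0; apply: lowMl.
  rewrite pscoefB pscoef_CM lE; apply/eqP; rewrite subr_eq0.
  have h q : c q * linU j p = c p * linU j q.
    have sym i : (q == j)%:R * linU i p - (q == i)%:R * linU j p =
        (p == j)%:R * linU i q - (p == i)%:R * linU j q.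
      by have [F _ hF] := koszul_hess i j; rewrite -!koszul_entry hF -{1}hess_sym mxE.
    have E (x y : 'I_n) : \sum_i c i * ((x == j)%:R * linU i y - (x == i)%:R * linU j y)
        = - (c x * linU j y).
      under eq_bigr => i _ do rewrite mulrBr mulrCA.
      rewrite sumrB -mulr_sumr cA mulr0 sub0r; congr (- _).
      rewrite (bigD1 x) //= eqxx mul1r big1 ?addr0 // => i /negbTE.
      by rewrite eq_sym => ->; rewrite mul0r mulr0.
    apply: oppr_inj; rewrite -!E; apply: eq_bigr => i _; by rewrite sym.
  have -> : pscoef (U j) U_(p)%MM = linU j p by rewrite mxE.
  by apply/eqP; rewrite mulrAC -[linU j q0 * _]mulrC -h mulrAC divff ?mul1r.
have d0 : \det linU != 0.
  apply/negP => /det0P[v v0 vA]; apply: nc; exists (fun i => v 0 i); split.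
    by apply/existsP; rewrite -negb_forall; apply: contra v0 => /forallP v0;
      apply/eqP/rowP => i; rewrite mxE; apply/eqP.
  by move=> p; have /rowP/(_ p) := vA; rewrite !mxE.
pose d := \det linU; pose D := \adj linU.
have AD : linU *m D = d%:M := mul_mx_adj linU.
have DA : D *m linU = d%:M := mul_adj_mx linU.
have conj X : alternating X -> X *m D + D^T *m X = 0.
  move=> /alternating_A h.
  have : d *: (X *m D + D^T *m X) = D^T *m (linU^T *m X + X *m linU) *m D.
    rewrite mulmxDr mulmxDl !mulmxA -trmx_mul AD tr_scalar_mx.
    rewrite -[D^T *m X *m linU *m D]mulmxA AD !mul_scalar_mx mul_mx_scalar.
    by rewrite -scalemxAl scalerDr.
  by rewrite h mulmx0 mul0mx => /eqP; rewrite scaler_eq0 (negbTE d0) => /eqP.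
pose N : 'M[k]_n := delta_mx i1 i0 - delta_mx i0 i1.
have N10 : N i1 i0 = 1 by rewrite !mxE !eqxx (negbTE i01) andbF subr0.
have Nalt : alternating N.
  split=> [|i]; first by rewrite /N linearB /= !trmx_delta opprB.
  by rewrite !mxE; have [->|] := eqVneq i i1;
    rewrite ?(negbTE i01) ?andbF ?andbT ?subrr // eq_sym (negbTE i01) subrr.
have [F FI NF] := koszul_hess i0 i1.
have [G FG lG] := low_split (Ilow FI).
have hF := hess_split FG lG; set Q := linear_part G in hF.
have [F1 _ QF1] := cramer_hess FI FG lG.
have e2 : Q^T *m D = D^T *m Q.
  by rewrite -[RHS]/((\adj linU)^T *m linear_part G) QF1 -hess_sym -QF1 trmx_mul trmxK.
have e3 : Q *m D = D^T *m Q^T.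
  have /conj : alternating (Q - Q^T).
    split=> [|i]; first by rewrite linearB /= trmxK opprB.
    by rewrite !mxE subrr.
  by rewrite mulmxBl mulmxBr e2 addrA subrK => /eqP; rewrite subr_eq0 => /eqP.
have NA : N *m linU = Q + Q^T by rewrite -hF -NF.
have dN : D^T *m (N *m linU) = d *: N.
  by rewrite NA mulmxDr -e2 -e3 addrC -mulmxDl -NA -mulmxA AD mul_mx_scalar.
have dN' : D^T *m (N *m linU) = - (d *: N).
  have /eqP := conj _ Nalt; rewrite addrC addr_eq0 => /eqP h.
  by rewrite mulmxA h mulNmx -mulmxA DA mul_mx_scalar.
have two0 : 2%:R = 0 :> k.
  have h : d *: N = - (d *: N) by rewrite -{1}dN dN'.
  have /eqP := congr1 (fun X : 'M[k]_n => X i1 i0) h.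
  rewrite [X in _ == X]mxE [(d *: N) _ _]mxE N10 mulr1 -subr_eq0.
  rewrite opprK -mulr2n -[d *+ 2]mulr_natr mulf_eq0 (negbTE d0) /=.
  by move/eqP.
have Malt : alternating (hess F1).
  split=> [|i].
    rewrite hess_sym; apply/eqP; rewrite -subr_eq0 opprK -mulr2n -scaler_nat.
    by rewrite two0 scale0r.
  by rewrite !mxE /= mnm1E eqxx -mulr_natr two0 mulr0.
have dQ : d *: Q = linU^T *m hess F1.
  by rewrite -QF1 mulmxA -trmx_mul DA tr_scalar_mx mul_scalar_mx.
have dQT : d *: Q^T = hess F1 *m linU.
  by rewrite -[RHS]trmxK trmx_mul hess_sym -dQ linearZ.
have : d *: N = 0.
  suff NA0 : d *: (N *m linU) = 0.
    have /eqP : d *: (d *: N) = 0 by rewrite -dN scalemxAr NA0 mulmx0.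
    by rewrite scaler_eq0 (negbTE d0) => /eqP.
  by rewrite NA scalerDr dQ dQT alternating_A.
by move=> /eqP; rewrite scaler_eq0 (negbTE d0) => /eqP N0; move: N10;
  rewrite N0 mxE => /eqP; rewrite eq_sym oner_eq0.
Qed.

End LinearPart.

(** * The bound on the length, and regularity *)

Lemma mul_leq_binomial n s : (0 < n)%N -> (2 <= s)%N ->
  (n * s.+1 <= 'C(n + s, s))%N.
Proof.
case: n s => [//|n] [|[|s]] // _ _; elim: n => [|n IH].
  by rewrite mul1n add1n binSn.
rewrite mulSn [(s.+3 + _)%N]addnC addSn binS leq_add //.
apply: (@leq_trans 'C(s.+3, s.+1)); last by apply: leq_bin2l; rewrite addSn ltnS leq_addl.
have -> : 'C(s.+3, s.+1) = 'C(s.+3, 2) 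
  by rewrite -(@bin_sub s.+3 2) // !subSS subn0.
by rewrite binS bin1 -[X in (X <= _)%N]add1n leq_add2r bin_gt0.
Qed.

Lemma h_inv_lt (R : comNzRingType) (M : lmodType R) q :
  (h_inv M < EFin q)%O ->
  exists phi : {linear M -> R^o}, (module_length (lmquot (lin_image phi)) < EFin q)%O.
Proof.
rewrite /h_inv; case: xgetP => [x _ [[phi _ <-] _] lt|_].
  by exists phi.
by rewrite ltNge leey.
Qed.

Section Regular.
Variables (n : nat) (k : fieldType) (I : idealr (pseries n k)).
Local Notation S := (pseries n k).
Local Notation R := {ideal_quot I}.
Local Notation proj := (proj I).
Hypothesis Ilow : forall f, f \in I -> low 2 f.

Lemma max_prime_maximal : maximal_ideal (prime_of (max_prime Ilow)).
Proof.
move=> J hJ x; apply/idP/idP; last exact: hJ.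
move=> xJ; apply/prime_ofP; have [f fE] := proj_surj x.
exists f => //; apply/eqP/negP => /negP f0.
have [g fg] := proj_unit I f0.
have : 1 \in J by rewrite -fg mulrC idealMr // -fE.
by rewrite idealr1.
Qed.

(** The maximal ideal of a regular local ring of dimension one is principal,
    while the classes of the variables are linearly independent modulo the
    square of the maximal ideal. *)
Lemma not_regular (i0 i1 : 'I_n) : i0 != i1 -> krull_dim R 1 ->
  ~ regular_local_ring R.
Proof.
move=> i01 [c1 cmax] [_ [mx [d [x [[mx_max mx_uniq] [cd _] mxE]]]]].
have d1 : (d <= 1)%N := cmax _ cd.
have mE : prime_of (max_prime Ilow) =i mx := mx_uniq _ max_prime_maximal.
have Xm i : proj (psX k i) \in mx.
  rewrite -mE; apply/prime_ofP; exists (psX k i) => //.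
  by apply: (@low_psX _ _ i); rewrite mdeg0.
have [y yE] : exists y : S, pscoef y 0%MM = 0 /\
    forall i, exists a, proj (psX k i) = proj (a * y).
  case: d x d1 mxE {cd} => [|[|//]] x _ xE.
    exists 0; split=> // i; exists 0.
    have := Xm i; rewrite xE => /ideal_gen_rangeP[c ->].
    by rewrite big_ord0 mul0r proj0.
  have : x ord0 \in mx.
    by rewrite xE; apply: span_mem; exists ord0.
  rewrite -mE => /prime_ofP[y y0 yE]; exists y; split=> // i.
  have := Xm i; rewrite xE => /ideal_gen_rangeP[c ->].
  have [a aE] := proj_surj (c ord0); exists a.
  by rewrite big_ord_recl big_ord0 addr0 aE yE projM.
have [y0 /choice[a aE]] := yE.
have ly : low 1 y.
  by move=> m; rewrite ltnS leqn0 mdeg_eq0 => /eqP->.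
have E i j : (i == j)%:R = pscoef (a i) 0%MM * pscoef y U_(j)%MM.
  have /proj_eq/Ilow/(_ U_(j)%MM) := aE i; rewrite mdeg1 => /(_ isT)/eqP.
  rewrite pscoefB subr_eq0 mulrC (pscoefM_low _ ly) ?mdeg1 // => /eqP h.
  by rewrite mulrC -h /= eq_mnm1 eq_sym.
have /eqP := E i0 i1; rewrite (negbTE i01) eq_sym mulf_eq0 => /orP[]/eqP z.
  by have /eqP := E i0 i0; rewrite z mul0r eqxx oner_eq0.
by have /eqP := E i1 i1; rewrite z mulr0 eqxx oner_eq0.
Qed.

End Regular.

(** * Torsion in the module of differentials *)

Theorem theorem1 (k : fieldType) (hk : perfect_field k)
  (n : nat) (hn : (2 <= n)%N)
  (I : idealr (pseries n k))
  (m : nat) (f : 'I_m -> pseries n k) (hf : I =i ideal_gen (range f))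
  (hdom : forall x y : {ideal_quot I}, x * y = 0 -> x = 0 \/ y = 0)
  (hdim : krull_dim {ideal_quot I} 1)
  (s : nat) (hs : (1 <= s)%N)
  (hI : {subset I <= ideal_exp (ps_max n k) s.+1})
  (hh : (h_inv (Omega I f) <
         EFin (('C(n + s, s))%:R * (s%:R / s.+1%:R) : rat))%O) :
  torsion (Omega I f) <> [set 0] /\
  (regular_local_ring {ideal_quot I} <-> torsion (Omega I f) = [set 0]).
Proof.
have Ilows g : g \in I -> low s.+1 g by move=> /hI; apply: low_ideal_exp.
have Ilow g : g \in I -> low 2 g by move=> /Ilows; apply: lowW.
pose i0 : 'I_n := Ordinal (ltnW hn); pose i1 : 'I_n := Ordinal hn.
have i01 : i0 != i1 by [].
suff tors : torsion (Omega I f) <> [set 0].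
  split=> //; split=> [reg|//]; exfalso.
  exact: (not_regular Ilow i01 hdim reg).
move=> torsion0; have [phi hphi] := h_inv_lt hh.
have hdim1 l : prime_chain {ideal_quot I} l -> (l <= 1)%N by case: hdim => _; apply.
have chain_bound r : (r * s.+1 <= 'C(n + s, s))%N ->
    ~ submod_chain (lmquot (lin_image phi)) ('C(n + s, s) - r).
  move=> rC /le_module_length h; have := le_lt_trans h hphi.
  rewrite lte_fin ltNge => /negP; apply.
  rewrite mulrA ler_pdivrMr ?ltr0n // -!natrM ler_nat.
  by move: 'C(n + s, s) rC => C rC; rewrite mulnBl mulnS addnC -addnBA // leq_addr.
have /choice[U hU] : forall i, exists g, proj I g = phi_dX phi i.
  by move=> i; have [g gE] := proj_surj (phi_dX phi i); exists g.
have [u0|u0] := pselect (exists i, phi_dX phi i != 0); last first.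
  (* Here [0] is a lift of each [phi_dX phi i] and the image of [phi] is zero. *)
  apply: (chain_bound 0%N) => //.
  have phi0 i : proj I 0 = phi_dX phi i.
    by rewrite proj0; apply/eqP/negP => /negP; rewrite eq_sym => ui; apply: u0; exists i.
  apply: (submod_chain_image Ilows phi0 (w := fun _ : 'I_0 => 0)) => // i.
  by exists (fun=> 0); rewrite big_ord0 subrr.
have lU i : low s (U i) := low_U hf hdom hdim1 hk hs Ilows i01 torsion0 hU i u0.
have [s1|s1] := eqVneq s 1%N.
  have [||l hl] := linear_part_rank1 Ilow (U := U) _ _ i01.
  - by move=> i; apply: lowW (lU i).
  - move=> g /proj_eq0/(syzygy_gradient hf hdom hdim1 hk hs Ilows torsion0 hU u0)[F FI hF].
    by exists F => // i; apply: lowW (hF i).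
  apply: (chain_bound 1%N); first by rewrite s1 bin1 mul1n addn1 ltnW.
  apply: (submod_chain_image Ilows hU (w := fun _ : 'I_1 => l)) => // i.
  have [c hc] := hl i; exists (fun=> c); rewrite big_ord_recl big_ord0 addr0 s1.
  exact: hc.
apply: (chain_bound n).
  by apply: mul_leq_binomial; [apply: ltnW|rewrite ltn_neqAle eq_sym s1].
apply: (submod_chain_image Ilows hU (w := U)) => // i.
exists (fun j => (j == i)%:R); rewrite (bigD1 i) //= eqxx psC1 mul1r big1 ?addr0 ?subrr //.
by move=> j /negbTE->; rewrite psC0 mul0r.
Qed.
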